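(* Let $\alpha=(\alpha_1,\dots,\alpha_n)\in\mathbb T^n$ be a nonzero vector, let $\mathbb Z^n$ act on the circle $\mathbb S^1=\mathbb R/2\pi\mathbb Z$ by $g(\varphi)=\varphi+g\alpha$, $g\alpha=g_1\alpha_1+\dots+g_n\alpha_n$, and let $$D=\sum_{g\in\mathbb Z^n,\;l\le m}T(g)\,b_{g,l}(x)\Bigl(-i\frac{d}{dx}\Bigr)^l:\;C^\infty(\mathbb S^1)\longrightarrow C^\infty(\mathbb S^1),\qquad (T(g)u)(x)=u(x-g\alpha),$$ where the smooth coefficients $b_{g,l}$ are rapidly decaying as $|g|\to\infty$. Suppose that $D$ is elliptic, i.e. its symbol $\sigma(D)=\sigma_+\oplus\sigma_-$ is invertible in $C^\infty(S^*\mathbb S^1)\rtimes\mathbb Z^n=C^\infty(\mathbb S^1)\rtimes\mathbb Z^n\oplus C^\infty(\mathbb S^1)\rtimes\mathbb Z^n$. Then $$\operatorname{ind}D=-\frac1{2\pi i}\int_{\mathbb S^1}\Bigl[(\sigma_+^{-1}d\sigma_+)(0)-(\sigma_-^{-1}d\sigma_-)(0)\Bigr].$$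
   Context: $\mathbb T^n=(\mathbb R/2\pi\mathbb Z)^n$. The smooth crossed product $C^\infty(\mathbb S^1)\rtimes\mathbb Z^n$ is the algebra of functions $f:\mathbb Z^n\to C^\infty(\mathbb S^1)$ with $\sup_g\|f(g)\|_{C^k}(1+|g|)^l<\infty$ for all $k,l$, and product $(f_1f_2)(k)(x)=\sum_{g+h=k}f_1(g)(x+h\alpha)\,f_2(h)(x)$. The same formula defines $\Omega(\mathbb S^1)\rtimes\mathbb Z^n$ for differential forms (with pullback by the rotation by $h\alpha$), with differential $(df)(g)=d(f(g))$. Rapid decay of $b_{g,l}$ means that for each $l$ the function $g\mapsto b_{g,l}$ lies in $C^\infty(\mathbb S^1)\rtimes\mathbb Z^n$. The symbol of $D$ is $\sigma(D)=\{b_{g,m}(x)\xi^m\}_{g\in\mathbb Z^n}$ on $S^*\mathbb S^1=\{(x,\xi):\xi=\pm1\}=\mathbb S^1\sqcup\mathbb S^1$, and $\sigma_\pm=\{b_{g,m}(x)(\pm1)^m\}_{g}$ are its components at $\xi=\pm1$. $(\sigma_\pm^{-1}d\sigma_\pm)(0)$ is the value at $0\in\mathbb Z^n$ of the noncommutative 1-form $\sigma_\pm^{-1}d\sigma_\pm$, and $\mathbb S^1$ has its standard orientation. An elliptic $D$ is Fredholm and $\operatorname{ind}D=\dim\ker D-\dim\operatorname{coker}D$. *)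

(* Defs.v *)
From HB Require Import structures.
From mathcomp Require Import all_boot all_order all_algebra.
From mathcomp Require Import complex.
From mathcomp Require Import all_classical all_reals all_analysis.

Set Implicit Arguments.
Unset Strict Implicit.
Unset Printing Implicit Defensive.

Import Order.TTheory GRing.Theory Num.Theory.
Import numFieldNormedType.Exports.

Local Open Scope classical_set_scope.
Local Open Scope ring_scope.
Local Open Scope complex_scope.

Section Index.
Variables (K : fieldType) (E : lmodType K).

(* dim (U / W) = p, for linear subspaces W of U: there are e_1, ..., e_p in U
   whose classes modulo W form a basis of U / W. *)
Definition has_quotient_dim (U W : set E) (p : nat) : Prop :=
  exists e : 'I_p -> E, (forall i, U (e i)) /\
    forall v, U v -> exists! c : 'rV[K]_p, W (v - \sum_i c 0 i *: e i).

(* 0 if the quotient is infinite dimensional. *)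
Definition quotient_dim (U W : set E) : nat :=
  xget 0%N [set p | has_quotient_dim U W p].

(* Operators are total functions on the ambient space E, of which only the
   restriction to the subspace V matters. *)
Definition linear_endo (V : set E) (D : E -> E) : Prop :=
  (forall u, V u -> V (D u)) /\
  (forall (a : K) u v, V u -> V v -> D (a *: u + v) = a *: D u + D v).

Definition ker_on (V : set E) (D : E -> E) : set E := [set u | V u /\ D u = 0].

Definition fredholm (V : set E) (D : E -> E) : Prop :=
  [/\ linear_endo V D,
      exists p, has_quotient_dim (ker_on V D) [set 0] p &
      exists q, has_quotient_dim V (D @` V) q].

Definition fredholm_index (V : set E) (D : E -> E) : int :=
  (quotient_dim (ker_on V D) [set 0])%:Z - (quotient_dim V (D @` V))%:Z.

End Index.

Section Circle.
Variable R : realType.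

(* R[i] with its structure of vector space over itself; functions on the circle
   R / 2 pi Z are 2 pi-periodic functions on R. *)
Notation C := (R[i]^o).

Definition cderivable (f : R -> C) (x : R) : Prop :=
  derivable (fun y => complex.Re (f y)) x 1 /\ derivable (fun y => complex.Im (f y)) x 1.

Definition cderive (f : R -> C) : R -> C :=
  fun x => derive1 (fun y => complex.Re (f y)) x +i*
           derive1 (fun y => complex.Im (f y)) x.

Definition Cinf_circle : set (R -> C) :=
  [set f | (forall x, f (x + 2 * pi) = f x) /\
           (forall k x, cderivable (iter k cderive f) x)].

(* The integral of the 1-form f(x) dx over the circle with its standard
   orientation. *)
Definition circle_int (f : R -> C) : C :=
  (\int[@lebesgue_measure R]_(x in `[0, 2 * pi]) complex.Re (f x)) +i*
  (\int[@lebesgue_measure R]_(x in `[0, 2 * pi]) complex.Im (f x)).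

(* Sum of an absolutely summable family, indexed by an arbitrary set. *)
Definition rsum (I : choiceType) (f : I -> R) : R :=
  fine (\esum_(i in [set: I]) (f^\+ i)%:E) -
  fine (\esum_(i in [set: I]) (f^\- i)%:E).

Definition csum (I : choiceType) (f : I -> C) : C :=
  rsum (fun i => complex.Re (f i)) +i* rsum (fun i => complex.Im (f i)).

Section CrossedProduct.
Variable n : nat.
Local Notation Zn := 'rV[int]_n.

(* A family f(g)(x); it stands for an element of C^oo(S^1) x| Z^n as well as
   for the 1-form {f(g)(x) dx}_g in Omega^1(S^1) x| Z^n. *)
Notation family := (Zn -> R -> C).

Definition absZn (g : Zn) : R := \sum_i `|(g 0 i)%:~R|.

Definition in_crossed (f : family) : Prop :=
  (forall g, Cinf_circle (f g)) /\
  forall k l : nat, exists M : R, forall g (j : nat) x, (j <= k)%N ->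
    ComplexField.Normc.normc (iter j cderive (f g) x) * (1 + absZn g) ^+ l <= M.

Variable alpha : 'rV[R]_n.

(* A representative in R of the angle g alpha. *)
Definition angle (g : Zn) : R := \sum_i (g 0 i)%:~R * alpha 0 i.

(* The sum over g + h = k is indexed by h, with g = k - h. Since dx is
   invariant under rotations, this is also the product of a function and a
   1-form. *)
Definition crossed_mul (f1 f2 : family) : family :=
  fun k x => csum (fun h : Zn => f1 (k - h) (x + angle h) * f2 h x).

Definition crossed_one : family := fun g _ => (g == 0)%:R.

Definition crossed_d (f : family) : family := fun g => cderive (f g).

Definition crossed_inverse (f f' : family) : Prop :=
  [/\ in_crossed f', crossed_mul f f' = crossed_one &
      crossed_mul f' f = crossed_one].

Definition crossed_invertible (f : family) : Prop :=
  exists f', crossed_inverse f f'.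

Definition crossed_inv (f : family) : family :=
  xget (fun _ _ => 0) [set f' | crossed_inverse f f'].

Definition Tshift (g : Zn) (u : R -> C) : R -> C := fun x => u (x - angle g).

Definition Dx (u : R -> C) : R -> C := fun x => - 'i%C * cderive u x.

(* b g l is the coefficient b_{g,l}; only l <= m is used. *)
Definition diff_op (m : nat) (b : Zn -> nat -> R -> C) (u : R -> C) : R -> C :=
  fun x => csum (fun g : Zn =>
    \sum_(l < m.+1) Tshift g (fun y => b g l y * iter l Dx u y) x).

Definition symbol (m : nat) (b : Zn -> nat -> R -> C) (xi : C) : family :=
  fun g x => b g m x * xi ^+ m.

Definition elliptic (m : nat) (b : Zn -> nat -> R -> C) : Prop :=
  crossed_invertible (symbol m b 1) /\ crossed_invertible (symbol m b (-1)).

(* The coefficient of dx in (sigma^-1 d sigma)(0). *)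
Definition log_derive0 (sigma : family) : R -> C :=
  crossed_mul (crossed_inv sigma) (crossed_d sigma) 0.

End CrossedProduct.
End Circle.

(* Main.v *)
Require Import Defs.
From HB Require Import structures.
From mathcomp Require Import all_boot all_order all_algebra.
From mathcomp Require Import complex.
From mathcomp Require Import all_classical all_reals all_analysis.
From mathcomp Require Import ring lra zify.

(** The symbol of a differential operator satisfies sigma_- = (-1)^m sigma_+, so
    the integrand vanishes identically and one has to show that an elliptic [D]
    is Fredholm of index zero. Modulo finite rank operators d/dx equals the
    bijection E u = u' + u(0) of C^oo(S^1), so [D] equals
    b_m (1 + B J) E^m, where J inverts E, b_m acts bijectively because it is
    invertible in the crossed product, and B is bounded in every C^j norm.
    Fejer interpolation F on a fine grid is a finite rank operator with
    |u - F u| <= e |u'|, so 1 + B (1 - F) J is inverted by a Neumann series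
    which converges in the sup norm, and in every C^j since J gains a derivative.
    Hence [D] is a finite rank perturbation of a bijection. *)

Set Implicit Arguments.
Unset Strict Implicit.
Unset Printing Implicit Defensive.

Import Order.TTheory GRing.Theory Num.Theory.
Import numFieldNormedType.Exports.

Local Open Scope classical_set_scope.
Local Open Scope ring_scope.
Local Open Scope complex_scope.

(** * Finite rank perturbations of bijections *)

Section LinearAlgebra.
Variables (K : fieldType) (E : lmodType K).
Implicit Types (U V W : set E) (A B D G : E -> E) (u v w : E).

(** Kernel and cokernel dimensions are purely algebraic here, so an explicit finite rank remainder
    reduces the index to matrices, with no compact operators on completions. The obstacle is that
    C^oo(S^1) is not a Banach space: the bound of B in C^j may grow with j, so no single F can be
    expected to make B (1 - F) J contract in all these norms. The contraction is therefore arranged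
    in the sup norm alone, and the derivative gained by J carries the geometric decay from C^j to
    C^(j+1). Fejer kernels are chosen because they are nonnegative, sum to 1 over the nodes and are
    explicitly small away from the diagonal, so that a bound on u' becomes a uniform error. On the
    side of the integral, the sign (-1)^m occurs once in the inverse of the symbol and once in its
    differential; that these two signs cancel rests on uniqueness of inverses, hence on
    associativity of the crossed product. *)

Definition is_subspace W := W 0 /\ forall (a : K) u v, W u -> W v -> W (a *: u + v).

Lemma subspaceD W u v : is_subspace W -> W u -> W v -> W (u + v).
Proof. by case=> _ h Wu Wv; rewrite -[u]scale1r; apply: h. Qed.

Lemma subspaceZ W (a : K) u : is_subspace W -> W u -> W (a *: u).
Proof. by case=> W0 h Wu; rewrite -[_ *: _]addr0; apply: h. Qed.

Lemma subspaceN W u : is_subspace W -> W u -> W (- u).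
Proof. by move=> sW Wu; rewrite -scaleN1r; apply: subspaceZ. Qed.

Lemma subspaceB W u v : is_subspace W -> W u -> W v -> W (u - v).
Proof. by move=> sW Wu Wv; apply: subspaceD => //; apply: subspaceN. Qed.

Lemma subspace_sum W (I : Type) (r : seq I) (P : pred I) (F : I -> E) :
  is_subspace W -> (forall i, P i -> W (F i)) -> W (\sum_(i <- r | P i) F i).
Proof.
move=> sW WF; elim/big_ind: _ => //; first by case: sW.
by move=> u v; apply: subspaceD.
Qed.

(** Expanding each system of representatives in the other gives matrices [MA] and [MB]. Uniqueness
    of the coordinates of [e i] forces [MA *m MB = 1], so [p] is the rank of a product that factors
    through dimension [q]. *)
Lemma has_quotient_dim_le W U p q : is_subspace W ->
  has_quotient_dim U W p -> has_quotient_dim U W q -> (p <= q)%N.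
Proof.
move=> sW [e [Ue he]] [f [Uf hf]].
have /choice[A hA] i : exists c : 'rV[K]_q, W (e i - \sum_j c 0 j *: f j).
  by have [c [hc _]] := hf _ (Ue i); exists c.
have /choice[B hB] i : exists c : 'rV[K]_p, W (f i - \sum_j c 0 j *: e j).
  by have [c [hc _]] := he _ (Uf i); exists c.
pose MA := \matrix_i A i; pose MB := \matrix_i B i.
suff h : MA *m MB = 1%:M.
  rewrite -[p](@mxrank1 K) -h (leq_trans (mxrankM_maxl _ _)) //.
  exact: rank_leq_col.
apply/row_matrixP => i; rewrite row1 row_mul rowK.
have [c [hc cu]] := he _ (Ue i).
rewrite -(cu (delta_mx 0 i)); last first.
  rewrite (bigD1 i) //= mxE !eqxx scale1r big1 ?addr0 ?subrr; first by case: sW.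
  by move=> j ji; rewrite mxE (negPf ji) andbF scale0r.
(* The difference splits into the error of expanding [e i] in [f] and a combination of the errors of
   expanding the [f j] in [e], all of them in [W]. *)
apply/esym/cu; rewrite (_ : _ - _ = (e i - \sum_j A i 0 j *: f j)
   + \sum_j A i 0 j *: (f j - \sum_k B j 0 k *: e k)).
  apply: subspaceD => //; apply: subspace_sum => // j _; exact: subspaceZ.
under [X in _ = _ + X]eq_bigr => j _ do rewrite scalerBr.
rewrite sumrB addrA subrK; congr (_ - _).
under [RHS]eq_bigr => j _ do rewrite scaler_sumr.
rewrite exchange_big; apply: eq_bigr => k _ /=.
rewrite mxE scaler_suml; apply: eq_bigr => j _.
by rewrite scalerA !mxE.
Qed.

Lemma quotient_dimE W U p : is_subspace W -> has_quotient_dim U W p ->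
  quotient_dim U W = p.
Proof.
move=> sW hp; rewrite /quotient_dim; case: xgetP => [q _ hq|/(_ p)] //.
by apply/eqP; rewrite eqn_leq (has_quotient_dim_le sW hq hp) (has_quotient_dim_le sW hp hq).
Qed.

Lemma subspace0 : is_subspace [set 0].
Proof. by split=> // a u v -> ->; rewrite scaler0 addr0. Qed.

Section Endo.
Variable V : set E.
Hypothesis sV : is_subspace V.

Lemma linear_endo_in A u : linear_endo V A -> V u -> V (A u).
Proof. by case=> h _; apply: h. Qed.

Lemma linear_endoD A u v : linear_endo V A -> V u -> V v -> A (u + v) = A u + A v.
Proof. by case=> _ h Vu Vv; rewrite -[u in LHS]scale1r h // scale1r. Qed.

Lemma linear_endo0 A : linear_endo V A -> A 0 = 0.
Proof.
case=> _ h; have V0 : V 0 by case: sV.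
by have := h (-1) 0 0 V0 V0; rewrite scaler0 addr0 scaleN1r addNr.
Qed.

Lemma linear_endoZ A a u : linear_endo V A -> V u -> A (a *: u) = a *: A u.
Proof.
move=> lA Vu; have V0 : V 0 by case: sV.
by rewrite -[a *: u]addr0 (lA.2 a u 0) // (linear_endo0 lA) addr0.
Qed.

Lemma linear_endoN A u : linear_endo V A -> V u -> A (- u) = - A u.
Proof. by move=> lA Vu; rewrite -scaleN1r linear_endoZ // scaleN1r. Qed.

Lemma linear_endoB A u v : linear_endo V A -> V u -> V v -> A (u - v) = A u - A v.
Proof.
move=> lA Vu Vv; rewrite (linear_endoD lA Vu (subspaceN sV Vv)).
by rewrite (linear_endoN lA Vv).
Qed.

Lemma linear_endo_sum A (I : Type) (r : seq I) (P : pred I) (F : I -> E) :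
  linear_endo V A -> (forall i, P i -> V (F i)) ->
  A (\sum_(i <- r | P i) F i) = \sum_(i <- r | P i) A (F i).
Proof.
move=> lA VF; elim: r => [|i r IH]; first by rewrite !big_nil linear_endo0.
rewrite !big_cons; case: ifP => // Pi; rewrite linear_endoD ?IH //; first exact: VF.
exact: subspace_sum.
Qed.

Lemma linear_endo_id : linear_endo V id. Proof. by split. Qed.

Lemma linear_endo_comp A B : linear_endo V A -> linear_endo V B ->
  linear_endo V (A \o B).
Proof.
move=> [VA lA] [VB lB]; split=> [u /VB/VA//|a u v Vu Vv] /=.
by rewrite lB ?lA //; exact: VB.
Qed.

Lemma linear_endo_add A B : linear_endo V A -> linear_endo V B ->
  linear_endo V (fun u => A u + B u).
Proof.
move=> [VA lA] [VB lB]; split=> [u Vu|a u v Vu Vv].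
  by apply: subspaceD => //; [exact: VA|exact: VB].
by rewrite lA ?lB // scalerDr addrACA.
Qed.

Lemma linear_endo_scale (a : K) A : linear_endo V A -> linear_endo V (fun u => a *: A u).
Proof.
move=> [VA lA]; split=> [u Vu|c u v Vu Vv]; first by apply: subspaceZ => //; exact: VA.
by rewrite lA // scalerDr !scalerA mulrC.
Qed.

Lemma linear_endo_iter A k : linear_endo V A -> linear_endo V (iter k A).
Proof.
move=> lA; elim: k => [|k IH]; first exact: linear_endo_id.
exact: linear_endo_comp lA IH.
Qed.

(** Stability of [V] under [A] is left to [linear_endo]; values outside [V] are unconstrained,
    operators being total functions. *)
Definition bijective_endo A :=
  (forall u v, V u -> V v -> A u = A v -> u = v) /\
  (forall w, V w -> exists2 u, V u & A u = w).

Lemma bijective_endo_comp A B : linear_endo V B -> bijective_endo A -> bijective_endo B ->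
  bijective_endo (A \o B).
Proof.
move=> lB [iA sA] [iB sB]; split=> [u v Vu Vv /= /iA h|w /sA[v /sB[u Vu <-] <-]].
  by apply: iB => //; apply: h; exact: (linear_endo_in lB).
by exists u.
Qed.

Lemma bijective_endo_id : bijective_endo id.
Proof. by split=> // w Vw; exists w. Qed.

Lemma bijective_endo_iter A k : linear_endo V A -> bijective_endo A ->
  bijective_endo (iter k A).
Proof.
move=> lA bA; elim: k => [|k IH]; first exact: bijective_endo_id.
exact: bijective_endo_comp (linear_endo_iter k lA) bA IH.
Qed.

(** The inverse is chosen pointwise, with value 0 outside [V]; its linearity is pulled back through
    the injectivity of [A]. *)
Lemma bijective_endo_inverse A : linear_endo V A -> bijective_endo A ->
  exists B, [/\ linear_endo V B, {in V, cancel A B} & {in V, cancel B A}].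
Proof.
move=> lA [iA sA].
have /choice[B hB] w : exists u, V w -> V u /\ A u = w.
  have [Vw|nVw] := pselect (V w); last by exists 0.
  by have [u Vu Au] := sA _ Vw; exists u.
exists B; split.
- split=> [w /hB[]//|a u v Vu Vv]; have [VBu ABu] := hB _ Vu; have [VBv ABv] := hB _ Vv.
  have Vuv : V (a *: u + v) by apply: sV.2.
  have [VB AB] := hB _ Vuv; apply: iA => //; first exact: sV.2.
  by rewrite lA.2 // ABu ABv.
- move=> u /set_mem Vu; have [VB AB] := hB _ (linear_endo_in lA Vu); exact: iA.
- by move=> u /set_mem/hB[].
Qed.

(** An explicit factorisation through [K^N], rather than a finite dimensional image, so that kernel
    and cokernel of a perturbation reduce to a matrix built from [lam]. *)
Definition finite_rank A := exists N (lam : E -> 'rV[K]_N) (r : 'I_N -> E),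
  [/\ forall (a : K) u v, V u -> V v -> lam (a *: u + v) = a *: lam u + lam v,
      forall j, V (r j) &
      forall v, V v -> A v = \sum_j lam v 0 j *: r j].

Lemma eq_finite_rank A B : (forall v, V v -> A v = B v) -> finite_rank A -> finite_rank B.
Proof.
by move=> AB [N [l [r [? ? h]]]]; exists N, l, r; split=> // v Vv; rewrite -AB ?h.
Qed.

Lemma finite_rank0 : finite_rank (fun=> 0).
Proof.
exists 0%N, (fun=> 0), (fun=> 0); split=> [a u v _ _|_|v _].
- by rewrite scaler0 addr0.
- by case: sV.
- by rewrite big_ord0.
Qed.

Lemma finite_rank1 (lam : E -> K) (r : E) :
  (forall (a : K) u v, V u -> V v -> lam (a *: u + v) = a * lam u + lam v) ->
  V r -> finite_rank (fun v => lam v *: r).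
Proof.
move=> ll Vr; exists 1%N, (fun v => (lam v)%:M), (fun=> r); split=> // [a u v Vu Vv|v _].
  by rewrite ll // raddfD /= -scalemx1 -scalerA scalemx1.
by rewrite big_ord1 mxE eqxx mulr1n.
Qed.

Lemma finite_rank_add A B : finite_rank A -> finite_rank B ->
  finite_rank (fun v => A v + B v).
Proof.
move=> [N [l [r [ll Vr hA]]]] [N' [l' [r' [ll' Vr' hB]]]].
exists (N + N')%N, (fun v => row_mx (l v) (l' v)),
  (fun j => match fintype.split j with inl i => r i | inr i => r' i end); split.
- by move=> a u v Vu Vv; rewrite ll // ll' // scale_row_mx add_row_mx.
- by move=> j; case: fintype.splitP.
move=> v Vv; rewrite hA // hB // big_split_ord /=; congr (_ + _).
  apply: eq_bigr => j _; rewrite row_mxEl; case: fintype.splitP => k /= jk.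
    by congr (_ *: r _); apply: val_inj.
  by have := ltn_ord j; rewrite jk ltnNge leq_addr.
apply: eq_bigr => j _; rewrite row_mxEr; case: fintype.splitP => k /= jk.
  by have := ltn_ord k; rewrite -jk ltnNge leq_addr.
by congr (_ *: r' _); apply: val_inj => /=; apply/eqP; rewrite -(eqn_add2l N) jk.
Qed.

Lemma finite_rank_sum (I : Type) (r : seq I) (P : pred I) (A : I -> E -> E) :
  (forall i, P i -> finite_rank (A i)) ->
  finite_rank (fun v => \sum_(i <- r | P i) A i v).
Proof.
move=> fA; elim: r => [|i r IH].
  by apply: eq_finite_rank finite_rank0 => v _; rewrite big_nil.
have [Pi|nPi] := boolP (P i); last first.
  by apply: eq_finite_rank IH => v _; rewrite big_cons (negPf nPi).
by apply: eq_finite_rank (finite_rank_add (fA _ Pi) IH) => v _; rewrite big_cons Pi.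
Qed.

Lemma finite_rank_compl A B : linear_endo V A -> finite_rank B -> finite_rank (A \o B).
Proof.
move=> lA [N [l [r [ll Vr h]]]]; exists N, l, (A \o r); split=> // [j|v Vv] /=.
  by exact: (linear_endo_in lA).
rewrite h // linear_endo_sum //; last by move=> j _; apply: subspaceZ.
by apply: eq_bigr => j _; rewrite linear_endoZ.
Qed.

Lemma finite_rank_compr A B : finite_rank A -> linear_endo V B -> finite_rank (A \o B).
Proof.
move=> [N [l [r [ll Vr h]]]] [VB lB]; exists N, (l \o B), r; split=> // [a u v Vu Vv|v Vv] /=.
  by rewrite lB // ll //; exact: VB.
by rewrite h //; exact: VB.
Qed.

(* With [lam] mapping [V] to row vectors and [P = 1 + M], [M] the matrix of
   [lam (s_k)], the kernel of [1 + sum_j lam_j s_j] is isomorphic to that of [P]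
   and its image is the preimage by [lam] of the image of [P]; the latter is
   complemented within the image of [M], hence within that of [lam]. *)
Lemma id_plus_finite_rank_dim N (lam : E -> 'rV[K]_N) (s : 'I_N -> E) :
  (forall (a : K) u v, V u -> V v -> lam (a *: u + v) = a *: lam u + lam v) ->
  (forall j, V (s j)) ->
  let S := fun v => v + \sum_j lam v 0 j *: s j in
  exists p, has_quotient_dim (ker_on V S) [set 0] p /\ has_quotient_dim V (S @` V) p.
Proof.
move=> ll Vs S.
have V0 : V 0 by case: sV.
have lam0 : lam 0 = 0.
  by have := ll (-1) 0 0 V0 V0; rewrite scaler0 addr0 scaleN1r addNr.
have lamZ a u : V u -> lam (a *: u) = a *: lam u.
  by move=> Vu; rewrite -[_ *: u]addr0 ll // lam0 addr0.
have lamD u v : V u -> V v -> lam (u + v) = lam u + lam v.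
  by move=> Vu Vv; rewrite -[u in LHS]scale1r ll // scale1r.
have lamS n (c : 'I_n -> K) (f : 'I_n -> E) : (forall j, V (f j)) ->
    lam (\sum_j c j *: f j) = \sum_j c j *: lam (f j).
  move=> Vf; suff [] : V (\sum_j c j *: f j) /\
    lam (\sum_j c j *: f j) = \sum_j c j *: lam (f j) by [].
  elim/big_rec2: _ => // j y x _ [Vx hx]; split.
    by apply: subspaceD => //; apply: subspaceZ.
  by rewrite ll // hx.
pose M := \matrix_j lam (s j).
pose sg (c : 'rV[K]_N) := \sum_j c 0 j *: s j.
have Vsg c : V (sg c) by apply: subspace_sum => // j _; apply: subspaceZ.
have lsg c : lam (sg c) = c *m M.
  rewrite lamS // mulmx_sum_row; apply: eq_bigr => j _.
  by rewrite rowK.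
have sgD c d : sg (c + d) = sg c + sg d.
  by rewrite -big_split; apply: eq_bigr => j _; rewrite mxE scalerDl.
have sgZ a c : sg (a *: c) = a *: sg c.
  by rewrite scaler_sumr; apply: eq_bigr => j _; rewrite mxE scalerA.
have sgS n (c : 'I_n -> K) (f : 'I_n -> 'rV_N) :
    sg (\sum_j c j *: f j) = \sum_j c j *: sg (f j).
  elim/big_rec2: _ => [|j y x _ <-]; last by rewrite sgD sgZ.
  by apply: big1 => j _; rewrite mxE scale0r.
pose P := 1%:M + M.
have SE v : S v = v + sg (lam v) by [].
have imP f : V f -> (S @` V) f <-> (lam f <= P)%MS.
  move=> Vf; split=> [[v Vv <-]|/submxP[c hc]].
    rewrite SE lamD // lsg; apply/submxP; exists (lam v).
    by rewrite mulmxDr mulmx1.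
  (* When [lam f = c *m P], the vector [f - sg c] has [lam] equal to [c], hence is mapped to [f] by
     [S]. *)
  have Vv : V (f - sg c) by apply: subspaceB.
  exists (f - sg c) => //; rewrite SE -[lam _](_ : c = _) ?subrK //.
  by rewrite -scaleN1r addrC ll // lsg hc mulmxDr mulmx1 scaleN1r addrC addrK.
have sS : is_subspace (S @` V).
  split; first by exists 0 => //; rewrite SE lam0 add0r -[0 in LHS](scale0r 0) sgZ scale0r.
  move=> a _ _ [u Vu <-] [v Vv <-]; exists (a *: u + v); first exact: sV.2.
  by rewrite !SE ll // sgD sgZ scalerDr addrACA.
exists (N - \rank P)%N; split.
- pose B := row_base (kermx P).
  have rB : \rank (kermx P) = (N - \rank P)%N by rewrite mxrank_ker.
  suff : has_quotient_dim (ker_on V S) [set 0] (\rank (kermx P)) by rewrite rB.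
  (* If [c *m P = 0], then [lam (- sg c) = - (c *m M) = c], so [- sg] and [lam] are inverse to each
     other between the two kernels. *)
  exists (fun i => - sg (row i B)); split=> [i|v [Vv Sv]].
    have hB : row i B *m P = 0.
      by apply/sub_kermxP; rewrite (submx_trans (row_sub _ _)) // eq_row_base.
    split; first exact: subspaceN.
    have h : lam (- sg (row i B)) = row i B.
      rewrite -scaleN1r lamZ // lsg scaleN1r; apply/eqP.
      by rewrite eq_sym -addr_eq0 -[row i B in X in X + _]mulmx1 -mulmxDr hB.
    by rewrite SE h addNr.
  have vE : v = - sg (lam v) by apply/eqP; rewrite -addr_eq0 -SE Sv.
  have lB : (lam v <= B)%MS.
    rewrite eq_row_base; apply/sub_kermxP.
    rewrite mulmxDr mulmx1 -lsg -lamD // -SE Sv //.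
  have sum_B (c : 'rV_(\rank (kermx P))) :
      \sum_i c 0 i *: - sg (row i B) = - sg (c *m B).
    rewrite mulmx_sum_row sgS -sumrN; apply: eq_bigr => i _.
    by rewrite scalerN.
  exists (lam v *m pinvmx B); split=> [|c /= hc].
    by rewrite sum_B mulmxKpV // -vE /= subrr.
  have {}hc : v = - sg (c *m B) by move/eqP: hc; rewrite subr_eq0 sum_B => /eqP.
  apply: (row_free_inj (row_base_free (kermx P))); rewrite mulmxKpV //.
  have cP : c *m B *m P = 0.
    by apply/sub_kermxP; rewrite (submx_trans (submxMl _ _)) // eq_row_base.
  rewrite hc -scaleN1r lamZ // lsg scaleN1r; apply/eqP.
  by rewrite eq_sym -subr_eq0 opprK -[X in X + _]mulmx1 -mulmxDr -/P cP.
- pose B := row_base (P^C)%MS.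
  have rB : \rank (P^C)%MS = (N - \rank P)%N by rewrite mxrank_compl.
  suff : has_quotient_dim V (S @` V) (\rank (P^C)%MS) by rewrite rB.
  (* Now [lam (- sg c) = c - c *m P], which is [c] modulo the image of [P]; so a basis of a
     complement of that image yields a basis of the cokernel. *)
  exists (fun i => - sg (row i B)); split=> [i|v Vv]; first exact: subspaceN.
  have lE (c : 'rV_(\rank (P^C)%MS)) :
      lam (v - \sum_i c 0 i *: - sg (row i B)) = lam v - c *m B + c *m B *m P.
    have -> : \sum_i c 0 i *: - sg (row i B) = - sg (c *m B).
      rewrite mulmx_sum_row sgS -sumrN; apply: eq_bigr => i _.
      by rewrite scalerN.
    by rewrite opprK lamD // lsg mulmxDr mulmx1 addrA subrK.
  have VE (c : 'rV_(\rank (P^C)%MS)) : V (v - \sum_i c 0 i *: - sg (row i B)).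
    apply: subspaceB => //; apply: subspace_sum => // i _; apply: subspaceZ => //.
    exact: subspaceN.
  have iff (c : 'rV_(\rank (P^C)%MS)) :
      (S @` V) (v - \sum_i c 0 i *: - sg (row i B)) <-> (lam v - c *m B <= P)%MS.
    rewrite imP // lE; split=> h.
      by rewrite -[X in (X <= _)%MS](addrK (c *m B *m P)) addmx_sub // eqmx_opp submxMl.
    by rewrite addmx_sub // submxMl.
  have : (lam v <= P + B)%MS.
    apply: (submx_trans (submx_full (lam v) (addsmx_compl_full P))).
    by rewrite addsmxS // eq_row_base.
  case/sub_addsmxP=> -[c1 c2] /= hc.
  exists c2; split; first by apply/iff; rewrite hc addrK submxMl.
  move=> c /iff hc'; apply: (row_free_inj (row_base_free (P^C)%MS)); rewrite -/B.
  apply/eqP; rewrite -subr_eq0 -submx0 -(capmx_compl P) sub_capmx; apply/andP; split.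
    have -> : c2 *m B - c *m B = (lam v - c *m B) - c1 *m P.
      by rewrite hc addrAC [c1 *m P + _]addrC addrK.
    by rewrite addmx_sub // eqmx_opp submxMl.
  by rewrite -mulmxBl (submx_trans (submxMl _ _)) // eq_row_base.
Qed.

(** On [V], [D] is [G] composed with [S = 1 + sum_j lam_j H (r_j)], where [H] inverts [G]. Hence [D]
    and [S] have the same kernel, and [G] carries the image of [S] onto that of [D]; both defects of
    [S] have the same dimension. *)
Lemma bijective_plus_finite_rank_index D G : linear_endo V G -> bijective_endo G ->
  finite_rank (fun v => D v - G v) -> fredholm V D /\ fredholm_index V D = 0.
Proof.
move=> lG bG [N [lam [r [ll Vr hD]]]].
have [H [lH GK HK]] := bijective_endo_inverse lG bG.
pose s j := H (r j).
have Vs j : V (s j) by exact: (linear_endo_in lH).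
have [p [kp cp]] := id_plus_finite_rank_dim ll Vs.
set S := (fun v => _) in kp cp.
have VS v : V v -> V (S v).
  by move=> Vv; apply: subspaceD => //; apply: subspace_sum => // j _; apply: subspaceZ.
have DE v : V v -> D v = G (S v).
  move=> Vv; rewrite (linear_endoD lG) //; last first.
    by apply: subspace_sum => // j _; apply: subspaceZ.
  rewrite (linear_endo_sum _ lG); last by move=> j _; apply: subspaceZ.
  rewrite -[LHS](subrK (G v)) hD // addrC; congr (_ + _); apply: eq_bigr => j _.
  by rewrite (linear_endoZ _ lG) // HK //; apply: mem_set.
have lD : linear_endo V D.
  split=> [v Vv|a u v Vu Vv]; first by rewrite DE //; apply: (linear_endo_in lG); exact: VS.
  have Vuv : V (a *: u + v) by apply: sV.2.
  rewrite -[LHS](subrK (G (a *: u + v))) -[D u](subrK (G u)) -[D v](subrK (G v)).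
  rewrite !hD // lG.2 // scalerDr addrACA; congr (_ + _).
  rewrite scaler_sumr -big_split; apply: eq_bigr => j _.
  by rewrite ll // !mxE scalerDl scalerA.
have kE : ker_on V D = ker_on V S.
  apply/seteqP; split=> v [Vv h]; split=> //; last by rewrite DE // h (linear_endo0 lG).
  apply: bG.1; first exact: VS; first by case: sV.
  by rewrite (linear_endo0 lG) -DE.
have cD : has_quotient_dim V (D @` V) p.
  have [e [Ve he]] := cp; exists (G \o e); split=> [i|w Vw].
    exact: (linear_endo_in lG).
  have VHw : V (H w) by exact: (linear_endo_in lH).
  have Vc (c : 'rV[K]_p) : V (\sum_i c 0 i *: e i).
    by apply: subspace_sum => // j _; apply: subspaceZ.
  have hS (c : 'rV[K]_p) : (S @` V) (H w - \sum_i c 0 i *: e i) <->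
      (D @` V) (w - \sum_i c 0 i *: (G \o e) i).
    have wE : w - \sum_i c 0 i *: (G \o e) i = G (H w - \sum_i c 0 i *: e i).
      rewrite (linear_endoB lG) // HK; last exact: mem_set.
      rewrite (linear_endo_sum _ lG); last by move=> j _; apply: subspaceZ.
      by congr (_ - _); apply: eq_bigr => i _; rewrite (linear_endoZ _ lG).
    split=> -[v Vv h]; exists v => //; first by rewrite DE // h wE.
    by apply: bG.1; rewrite -?wE -?h ?DE //; [exact: VS|exact: subspaceB].
  have [c [hc cu]] := he _ VHw; exists c; split; first exact/hS.
  by move=> d /hS; apply: cu.
have sD : is_subspace (D @` V).
  split; first by exists 0; [case: sV|exact: linear_endo0].
  move=> a _ _ [u Vu <-] [v Vv <-]; exists (a *: u + v); first exact: sV.2.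
  by rewrite lD.2.
split; first by split=> //; exists p; rewrite // kE.
by rewrite /fredholm_index (quotient_dimE sD cD) kE (quotient_dimE subspace0 kp) subrr.
Qed.

End Endo.
End LinearAlgebra.

(** * Summable families of reals *)

Section Sums.
Variable R : realType.

Section OneIndex.
Variable I : choiceType.
Implicit Types (f g : I -> R) (w : I -> R).

Lemma esum_scale_le (c : R) (a : I -> \bar R) : (0 <= c)%R ->
  (forall i, (0 <= a i)%E) ->
  (\esum_(i in [set: I]) (c%:E * a i) <= c%:E * \esum_(i in [set: I]) a i)%E.
Proof.
move=> c0 a0; apply: ge_ereal_sup => _ [X [finX _] <-].
rewrite -ge0_mule_fsumr // lee_wpmul2l ?lee_fin //.
by apply: esum_ge; exists X.
Qed.

(** The missing inequality is [esum_scale_le] for the factor [c^-1] and the family [c * a]. *)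
Lemma esum_scale (c : R) (a : I -> \bar R) : (0 <= c)%R ->
  (forall i, (0 <= a i)%E) ->
  (\esum_(i in [set: I]) (c%:E * a i) = c%:E * \esum_(i in [set: I]) a i)%E.
Proof.
move=> c0 a0; apply/eqP; rewrite eq_le esum_scale_le //=.
have [->|cn0] := eqVneq c 0%R; first by rewrite mul0e esum_ge0 // => i _; rewrite mul0e.
have cp : (0 < c)%R by rewrite lt0r cn0.
rewrite -[leRHS]mul1e -(divff cn0) EFinM -muleA lee_wpmul2l ?lee_fin //.
have ci : (0 <= c^-1)%R by rewrite invr_ge0.
apply: le_trans (esum_scale_le ci _); last by move=> i; rewrite mule_ge0 ?lee_fin.
apply: le_esum => i _; rewrite muleA -EFinM mulVf // mul1e //.
Qed.

Definition abs_summable f := (\esum_(i in [set: I]) `|f i|%:E < +oo)%E.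

Lemma abs_summable_le f g : (forall i, `|f i| <= `|g i|) -> abs_summable g -> abs_summable f.
Proof. by move=> fg; apply: le_lt_trans; apply: le_esum => i _; rewrite lee_fin. Qed.

Lemma abs_summableN f : abs_summable f -> abs_summable (fun i => - f i).
Proof. by apply: abs_summable_le => i; rewrite normrN. Qed.

Lemma abs_summableD f g : abs_summable f -> abs_summable g ->
  abs_summable (fun i => f i + g i).
Proof.
move=> sf sg; apply: (@le_lt_trans _ _ (\esum_(i in [set: I]) (`|f i|%:E + `|g i|%:E))%E).
  by apply: le_esum => i _; rewrite -EFinD lee_fin ler_normD.
by rewrite esumD ?lte_add_pinfty // => i _; rewrite lee_fin.
Qed.

Lemma abs_summableZ c f : abs_summable f -> abs_summable (fun i => c * f i).
Proof.
move=> sf; rewrite /abs_summable.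
under eq_esum do rewrite normrM EFinM.
rewrite esum_scale // lte_mul_pinfty //.
Qed.

Lemma abs_summable_dom (C : R) w f : abs_summable w ->
  (forall i, `|f i| <= C * w i) -> abs_summable f.
Proof.
move=> sw h; apply: abs_summable_le (abs_summableZ C sw) => i.
exact: le_trans (h i) (ler_norm _).
Qed.

Lemma nonneg_sum_fin_num f : (forall i, 0 <= f i) -> abs_summable f ->
  (\esum_(i in [set: I]) (f i)%:E)%E \is a fin_num.
Proof.
move=> f0 sf; rewrite ge0_fin_numE; last by apply: esum_ge0 => i _; rewrite lee_fin.
apply: le_lt_trans sf; apply: le_esum => i _; rewrite lee_fin ler_norm //.
Qed.

Lemma funrpos_sub f i : f i = f^\+ i - f^\- i.
Proof. by rewrite -[in LHS](funrposBneg f). Qed.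

Lemma funr_abs f i : `|f i| = f^\+ i + f^\- i.
Proof. by rewrite -[LHS]/((Num.norm \o f) i) -funrposDneg. Qed.

Lemma abs_summable_pos f : abs_summable f -> abs_summable f^\+.
Proof.
apply: abs_summable_le => i; rewrite (ger0_norm (funrpos_ge0 f i)) funr_abs.
by rewrite lerDl funrneg_ge0.
Qed.

Lemma abs_summable_neg f : abs_summable f -> abs_summable f^\-.
Proof.
apply: abs_summable_le => i; rewrite (ger0_norm (funrneg_ge0 f i)) funr_abs.
by rewrite lerDr funrpos_ge0.
Qed.

(** From [f^\+ + q = f^\- + p] and additivity of nonnegative sums. Linearity and Fubini pass through
    this freedom in the decomposition, because positive parts are not additive. *)
Lemma rsum_sub f p q : abs_summable p -> abs_summable q ->
  (forall i, 0 <= p i) -> (forall i, 0 <= q i) -> (forall i, f i = p i - q i) ->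
  rsum f = fine (\esum_(i in [set: I]) (p i)%:E) - fine (\esum_(i in [set: I]) (q i)%:E).
Proof.
move=> sp sq p0 q0 fE.
have sf : abs_summable f.
  have := abs_summableD sp (abs_summableN sq).
  by apply: abs_summable_le => i; rewrite fE.
have fp := nonneg_sum_fin_num p0 sp; have fq := nonneg_sum_fin_num q0 sq.
have ff := nonneg_sum_fin_num (funrpos_ge0 f) (abs_summable_pos sf).
have fn := nonneg_sum_fin_num (funrneg_ge0 f) (abs_summable_neg sf).
have : (\esum_(i in [set: I]) (f^\+ i)%:E + \esum_(i in [set: I]) (q i)%:E =
       \esum_(i in [set: I]) (f^\- i)%:E + \esum_(i in [set: I]) (p i)%:E)%E.
  rewrite -!esumD; try by move=> i _; rewrite lee_fin ?funrpos_ge0 ?funrneg_ge0 ?p0 ?q0.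
  apply: eq_esum => i _; rewrite -!EFinD; congr EFin.
  by have := fE i; rewrite (funrpos_sub f); lra.
move/(congr1 fine); rewrite !fineD // => h.
by rewrite /rsum; lra.
Qed.

Lemma rsum_ge0E w : (forall i, 0 <= w i) -> abs_summable w ->
  rsum w = fine (\esum_(i in [set: I]) (w i)%:E).
Proof.
move=> w0 sw; rewrite (@rsum_sub w w (fun=> 0)) ?subr0 //.
- by rewrite (@esum1 _ _ _ (fun=> 0%:E)) ?subr0.
- by apply: abs_summable_le sw => i; rewrite normr0.
- by move=> i; rewrite subr0.
Qed.

Lemma eq_rsum f g : f =1 g -> rsum f = rsum g.
Proof. by move=> /funext ->. Qed.

Lemma rsumD f g : abs_summable f -> abs_summable g ->
  rsum (fun i => f i + g i) = rsum f + rsum g.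
Proof.
move=> sf sg.
have [p q] := (abs_summable_pos sf, abs_summable_neg sf).
have [p' q'] := (abs_summable_pos sg, abs_summable_neg sg).
rewrite (rsum_sub (p := fun i => f^\+ i + g^\+ i) (q := fun i => f^\- i + g^\- i)).
- under eq_esum do rewrite EFinD.
  under [X in _ - fine X]eq_esum do rewrite EFinD.
  rewrite !esumD; try by move=> i _; rewrite lee_fin ?funrpos_ge0 ?funrneg_ge0.
  rewrite !fineD ?nonneg_sum_fin_num //; try by move=> i; rewrite ?funrpos_ge0 ?funrneg_ge0.
  by rewrite /rsum; lra.
- exact: abs_summableD.
- exact: abs_summableD.
- by move=> i; rewrite addr_ge0 ?funrpos_ge0.
- by move=> i; rewrite addr_ge0 ?funrneg_ge0.
- by move=> i; rewrite (funrpos_sub f) (funrpos_sub g); lra.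
Qed.

Lemma rsum0 : rsum (fun _ : I => 0 : R) = 0.
Proof.
have s0 : abs_summable (fun=> 0).
  by rewrite /abs_summable esum1 // => i _; rewrite normr0.
by rewrite rsum_ge0E // (@esum1 _ _ _ (fun=> 0%:E)).
Qed.

Lemma rsumN f : rsum (fun i => - f i) = - rsum f.
Proof.
rewrite /rsum opprB; congr (fine _ - fine _); apply: eq_esum => i _;
  by rewrite /funrpos /funrneg ?opprK.
Qed.

Lemma rsumZ c f : abs_summable f -> rsum (fun i => c * f i) = c * rsum f.
Proof.
wlog c0 : c / 0 <= c => [h sf|sf].
  have [c0|/ltW c0] := leP 0 c; first exact: h.
  have := h (- c); rewrite oppr_ge0 => /(_ c0 sf).
  by under eq_rsum do rewrite mulNr; rewrite rsumN mulNr => /oppr_inj.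
rewrite (rsum_sub (p := fun i => c * f^\+ i) (q := fun i => c * f^\- i)).
- under eq_esum do rewrite EFinM.
  under [X in _ - fine X]eq_esum do rewrite EFinM.
  rewrite !esum_scale //; try by move=> i; rewrite lee_fin ?funrpos_ge0 ?funrneg_ge0.
  have fp := nonneg_sum_fin_num (funrpos_ge0 f) (abs_summable_pos sf).
  have fn := nonneg_sum_fin_num (funrneg_ge0 f) (abs_summable_neg sf).
  by rewrite !fineM // -mulrBr.
- by apply: abs_summableZ; exact: abs_summable_pos.
- by apply: abs_summableZ; exact: abs_summable_neg.
- by move=> i; rewrite mulr_ge0 ?funrpos_ge0.
- by move=> i; rewrite mulr_ge0 ?funrneg_ge0.
- by move=> i; rewrite -mulrBr -funrpos_sub.
Qed.

Lemma rsum_ge0 w : (forall i, 0 <= w i) -> abs_summable w -> 0 <= rsum w.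
Proof.
by move=> w0 sw; rewrite rsum_ge0E // fine_ge0 // esum_ge0 // => i _; rewrite lee_fin.
Qed.

Lemma rsum_norm_le (C : R) w f : abs_summable w -> (forall i, `|f i| <= C * w i) ->
  `|rsum f| <= C * rsum w.
Proof.
move=> sw h; have sf := abs_summable_dom sw h.
have sCw := abs_summableZ C sw.
have main g : abs_summable g -> (forall i, g i <= C * w i) -> rsum g <= C * rsum w.
  move=> sg gw; rewrite -subr_ge0 -rsumZ // -rsumN -rsumD //; last exact: abs_summableN.
  apply: rsum_ge0; first by move=> i; rewrite subr_ge0.
  by apply: abs_summableD => //; exact: abs_summableN.
rewrite ler_norml; apply/andP; split; last first.
  by apply: main => // i; exact: le_trans (ler_norm _) (h i).
rewrite lerNl -rsumN; apply: main; first exact: abs_summableN.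
by move=> i; apply: le_trans (h i); rewrite -normrN ler_norm.
Qed.

Lemma abs_summable_finite f (s : seq I) :
  (forall i, i \notin s -> f i = 0) -> abs_summable f.
Proof.
move=> fs; rewrite /abs_summable.
rewrite (_ : (\esum_(i in [set: I]) `|f i|%:E = \esum_(i in [set` s]) `|f i|%:E)%E).
  rewrite esum_fset ?finite_seq // fsbig_finite ?finite_seq //.
  by rewrite sumEFin ltry.
rewrite [RHS]esum_mkcond; apply: eq_esum => i _; case: ifPn => // h.
by rewrite fs ?normr0 //; apply: contra h => ?; apply: mem_set.
Qed.

Lemma rsum_delta (i0 : I) (a : R) : rsum (fun i => if i == i0 then a else 0) = a.
Proof.
have main (b : R) : 0 <= b -> rsum (fun i => if i == i0 then b else 0) = b.
  move=> b0; rewrite rsum_ge0E.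
  - have -> : (\esum_(i in [set: I]) (if i == i0 then b else 0)%:E = \esum_(i in [set i0]) b%:E)%E.
      rewrite [RHS]esum_mkcond; apply: eq_esum => i _.
      by rewrite (_ : (i \in _) = (i == i0)) ?(fun_if EFin) // in_set1.
    by rewrite esum_set1 ?lee_fin.
  - by move=> i; case: ifP.
  - by apply: (@abs_summable_finite _ [:: i0]) => i; rewrite inE => /negPf ->.
have [a0|/ltW a0] := leP 0 a; first exact: main.
have := main (- a); rewrite oppr_ge0 => /(_ a0)/(congr1 -%R).
rewrite opprK -rsumN => h; rewrite -[RHS]h; apply: eq_rsum => i.
by case: ifP; rewrite ?opprK ?oppr0.
Qed.

End OneIndex.

Lemma reindex_rsum (I J : choiceType) (e : I -> J) (f : J -> R) :
  bijective e -> rsum (fun i => f (e i)) = rsum f.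
Proof.
move=> be; have eb : set_bij [set: I] [set: J] e by rewrite setTT_bijective.
by rewrite /rsum (reindex_esum [set: I] _ e) // [X in _ = _ - fine X](reindex_esum [set: I] _ e).
Qed.

Lemma reindex_abs_summable (I J : choiceType) (e : I -> J) (f : J -> R) :
  bijective e -> abs_summable f -> abs_summable (fun i => f (e i)).
Proof.
move=> be; have eb : set_bij [set: I] [set: J] e by rewrite setTT_bijective.
by rewrite /abs_summable (reindex_esum [set: I] _ e).
Qed.

Section TwoIndices.
Variables I J : choiceType.
Implicit Types f : I * J -> R.

Lemma esum_pair (a : I * J -> \bar R) : (forall k, (0 <= a k)%E) ->
  (\esum_(i in [set: I]) \esum_(j in [set: J]) a (i, j) = \esum_(k in [set: I * J]) a k)%E.
Proof.
move=> a0; rewrite (@esum_esum _ _ _ [set: I] (fun=> [set: J]) (fun i j => a (i, j))) //.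
rewrite (_ : [set: I] `*`` _ = [set: I * J]); first by apply: eq_esum => -[].
by apply/seteqP; split=> -[].
Qed.

Lemma esum_ge_term (T : choiceType) (a : T -> \bar R) i : (forall k, (0 <= a k)%E) ->
  (a i <= \esum_(i in [set: T]) a i)%E.
Proof.
move=> a0; apply: esum_ge; exists [set i]; first by split.
by rewrite fsbig_set1.
Qed.

Lemma abs_summable_row f i : abs_summable f -> abs_summable (fun j => f (i, j)).
Proof.
rewrite /abs_summable -esum_pair //; apply: le_lt_trans.
apply: (@esum_ge_term I (fun i => \esum_(j in [set: J]) `|f (i, j)|%:E)%E) => k.
by apply: esum_ge0.
Qed.

Lemma nonneg_sum_pair f : (forall k, 0 <= f k) -> abs_summable f ->
  abs_summable (fun i => fine (\esum_(j in [set: J]) (f (i, j))%:E)%E) /\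
  (\esum_(i in [set: I]) (fine (\esum_(j in [set: J]) (f (i, j))%:E))%:E =
    \esum_(k in [set: I * J]) (f k)%:E)%E.
Proof.
move=> f0 sf; have E : (\esum_(i in [set: I]) (fine (\esum_(j in [set: J]) (f (i, j))%:E))%:E =
    \esum_(k in [set: I * J]) (f k)%:E)%E.
  rewrite -esum_pair //; apply: eq_esum => i _; rewrite fineK // nonneg_sum_fin_num //.
  exact: abs_summable_row sf.
split=> //; rewrite /abs_summable.
rewrite (_ : esum _ _ = (\esum_(k in [set: I * J]) (f k)%:E)%E); last first.
  rewrite -E; apply: eq_esum => i _; rewrite ger0_norm // fine_ge0 // esum_ge0 // => j _.
  by rewrite lee_fin.
have := nonneg_sum_fin_num f0 sf; rewrite ge0_fin_numE // esum_ge0 // => k _.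
by rewrite lee_fin.
Qed.

(** Tonelli is applied to the positive and negative parts of [f]. Their row sums need not be the
    positive and negative parts of the row sums of [f], so the outer sum is reassembled by
    [rsum_sub]. *)
Lemma rsum_fubini f : abs_summable f ->
  abs_summable (fun i => rsum (fun j => f (i, j))) /\
  rsum (fun i => rsum (fun j => f (i, j))) = rsum f.
Proof.
move=> sf; have [p q] := (abs_summable_pos sf, abs_summable_neg sf).
have [sp Ep] := nonneg_sum_pair (funrpos_ge0 f) p.
have [sq Eq] := nonneg_sum_pair (funrneg_ge0 f) q.
split.
  exact: (abs_summableD sp (abs_summableN sq)).
rewrite (rsum_sub sp sq) ?Ep ?Eq // => i; rewrite fine_ge0 // esum_ge0 // => j _.
  by rewrite lee_fin funrpos_ge0.
by rewrite lee_fin funrneg_ge0.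
Qed.

Lemma abs_summable_prod (w : I -> R) (w' : J -> R) :
  abs_summable w -> abs_summable w' -> abs_summable (fun k => w k.1 * w' k.2).
Proof.
move=> sw sw'; rewrite /abs_summable -esum_pair //=.
have fw : (\esum_(j in [set: J]) `|w' j|%:E)%E \is a fin_num.
  by apply: nonneg_sum_fin_num => //; apply: abs_summable_le sw' => j; rewrite normr_id.
rewrite (@eq_esum _ _ _ _ (fun i => (fine (\esum_(j in [set: J]) `|w' j|%:E))%:E * `|w i|%:E)%E).
  rewrite esum_scale ?fine_ge0 ?esum_ge0 // lte_mul_pinfty ?lee_fin ?fine_ge0 ?esum_ge0 //.
move=> i _; under eq_esum do rewrite normrM EFinM.
by rewrite esum_scale // muleC fineK.
Qed.

End TwoIndices.
End Sums.

(** * Smooth functions on the circle *)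

Section RealCalculus.
Variable R : realType.

(** Quadratic remainder estimates survive summation over a family, so this criterion gives termwise
    differentiation without a theorem on uniform limits. *)
Lemma is_derive_quadratic (f : R -> R) (x d B : R) :
  (forall h, `|f (x + h) - f x - h * d| <= B * h ^+ 2) -> is_derive x 1 f d.
Proof.
move=> hB.
have cv : h^-1 *: (f (h *: 1 + x) - f x) @[h --> 0^'] --> d.
  apply/cvgrPdist_lt => e e0.
  near=> h.
  have h0 : h != 0 by near: h; exact: nbhs_dnbhs_neq.
  have hn : 0 < `|h| by rewrite normr_gt0.
  have hs : (`|B| + 1) * `|h| < e.
    rewrite -ltr_pdivlMl ?ltr_wpDl //.
    near: h; apply: dnbhs0_lt; rewrite mulr_gt0 // invr_gt0 ltr_wpDl //.
  apply: le_lt_trans hs.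
  rewrite -(ler_pM2l hn) -normrM.
  rewrite [X in `|X|](_ : _ = - (f (x + h) - f x - h * d)); last first.
    by rewrite [h%:A]mulr1 [h + x]addrC /GRing.scale /=; field.
  rewrite normrN (le_trans (hB h)) // [leRHS]mulrCA -expr2 real_normK ?num_real //.
  by rewrite ler_wpM2r ?sqr_ge0 // (le_trans (ler_norm _)) // lerDl.
have dd : derivable f x 1 by apply/cvg_ex; exists d.
by apply: DeriveDef => //; apply: cvg_lim cv.
Unshelve. all: by end_near. Qed.

Lemma is_derive_continuous (f : R -> R) (x d : R) : is_derive x 1 f d -> {for x, continuous f}.
Proof. by case=> df _; apply/differentiable_continuous/derivable1_diffP. Qed.

Lemma mean_value (f f1 : R -> R) : (forall x : R, is_derive x 1 f (f1 x)) ->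
  forall a b, exists2 c, Num.min a b <= c <= Num.max a b & f b - f a = f1 c * (b - a).
Proof.
move=> df; have main a b : a < b -> exists2 c, Num.min a b <= c <= Num.max a b &
    f b - f a = f1 c * (b - a).
  move=> ab; have cf : {within `[a, b], continuous f}.
    by apply: continuous_subspaceT => x; exact: is_derive_continuous (df x).
  have [c] := MVT ab (fun x _ => df x) cf.
  rewrite in_itv /= => /andP[ac cb] h; exists c => //.
  by rewrite (min_idPl (ltW ab)) (max_idPr (ltW ab)) !ltW.
move=> a b; have [ab|ba|->] : [\/ a < b, b < a | a = b].
- by case: ltgtP => h; [apply: Or31|apply: Or32|apply: Or33].
- exact: main.
- have [c hc h] := main _ _ ba; exists c; first by rewrite minC maxC.
  by rewrite -opprB h -mulrN opprB.
- by exists b; rewrite ?minxx ?maxxx ?lexx // !subrr mulr0.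
Qed.

(** Two mean values: the remainder is [h * (f1 c - f1 x) = h * f2 e * (c - x)] with [c] between [x]
    and [x + h]. The sharp factor 1/2 is not sought. *)
Lemma taylor2 (f f1 f2 : R -> R) B : (forall x : R, is_derive x 1 f (f1 x)) ->
  (forall x : R, is_derive x 1 f1 (f2 x)) -> (forall x, `|f2 x| <= B) ->
  forall x h, `|f (x + h) - f x - h * f1 x| <= B * h ^+ 2.
Proof.
move=> d1 d2 hB x h.
have [c hc ->] := mean_value d1 x (x + h).
have [e he he'] := mean_value d2 x c.
rewrite [X in X - _]mulrC addrAC subrr add0r -mulrBr he' normrM normrM.
rewrite [leRHS](_ : _ = `|h| * (B * `|h|)); last first.
  by rewrite [RHS]mulrCA -expr2 real_normK ?num_real.
rewrite ler_wpM2l // ler_pM //.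
move: hc; rewrite /Num.min /Num.max; case: (ltP x (x + h)) => h1 /andP[h2 h3];
  rewrite ler_norml; apply/andP; split; case: (ger0P h); lra.
Qed.

(** Domination of the second derivatives makes the [taylor2] remainders summable, with total at most
    [M * rsum w * h ^+ 2]. *)
Lemma is_derive_rsum (I : choiceType) (r r1 r2 : I -> R -> R) (M : R) (w : I -> R) :
  abs_summable w ->
  (forall i (x : R), is_derive x 1 (r i) (r1 i x)) ->
  (forall i (x : R), is_derive x 1 (r1 i) (r2 i x)) ->
  (forall i x, [/\ `|r i x| <= M * w i, `|r1 i x| <= M * w i & `|r2 i x| <= M * w i]) ->
  forall x : R, is_derive x 1 (fun x => rsum (r^~ x)) (rsum (r1^~ x)).
Proof.
move=> sw d1 d2 hM x; apply: (@is_derive_quadratic _ _ _ (M * rsum w)) => h.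
have s0 y : abs_summable (r^~ y) by apply: (@abs_summable_dom _ _ M _ _ sw) => i; case: (hM i y).
have s1 y : abs_summable (r1^~ y) by apply: (@abs_summable_dom _ _ M _ _ sw) => i; case: (hM i y).
rewrite -rsumZ // -rsumN -rsumD //; last exact: abs_summableN.
rewrite -rsumN -rsumD; first last.
- by apply: abs_summableN; exact: abs_summableZ.
- by apply: abs_summableD => //; exact: abs_summableN.
rewrite mulrAC; apply: rsum_norm_le => // i.
rewrite mulrAC; apply: taylor2 => // y; by case: (hM i y).
Qed.

End RealCalculus.

Local Notation Re := complex.Re.
Local Notation Im := complex.Im.

(** * The norm |Re| + |Im| on complex numbers *)

Section ComplexNorm.
Variable R : realType.
Local Notation C := (R[i]^o).
Implicit Types z w : C.

Lemma cReD z w : Re (z + w) = Re z + Re w. Proof. by case: z w => ? ? []. Qed.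
Lemma cImD z w : Im (z + w) = Im z + Im w. Proof. by case: z w => ? ? []. Qed.
Lemma cReN z : Re (- z) = - Re z. Proof. by case: z. Qed.
Lemma cImN z : Im (- z) = - Im z. Proof. by case: z. Qed.
Lemma cReM z w : Re (z * w) = Re z * Re w - Im z * Im w. Proof. by case: z w => ? ? []. Qed.
Lemma cImM z w : Im (z * w) = Re z * Im w + Im z * Re w. Proof. by case: z w => ? ? []. Qed.

Lemma complex_ext z w : Re z = Re w -> Im z = Im w -> z = w.
Proof. by case: z w => ? ? [? ?] /= -> ->. Qed.

(* Equivalent to the modulus, and directly comparable to the real and imaginary
   parts in which [csum] and [cderive] are defined. *)
Definition norm1 z : R := `|Re z| + `|Im z|.

Lemma norm1_ge0 z : 0 <= norm1 z. Proof. by rewrite addr_ge0. Qed.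
Lemma norm10 : norm1 0 = 0. Proof. by rewrite /norm1 /= normr0 addr0. Qed.
Lemma norm1_eq0 z : norm1 z = 0 -> z = 0.
Proof.
move/eqP; rewrite paddr_eq0 // !normr_eq0 => /andP[/eqP a /eqP b].
exact: complex_ext.
Qed.
Lemma norm1D z w : norm1 (z + w) <= norm1 z + norm1 w.
Proof. by rewrite /norm1 cReD cImD addrACA lerD // ler_normD. Qed.
Lemma norm1N z : norm1 (- z) = norm1 z.
Proof. by rewrite /norm1 cReN cImN !normrN. Qed.
Lemma norm1M z w : norm1 (z * w) <= norm1 z * norm1 w.
Proof.
rewrite /norm1 cReM cImM mulrDl !mulrDr -!normrM.
have := ler_normB (Re z * Re w) (Im z * Im w).
have := ler_normD (Re z * Im w) (Im z * Re w); lra.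
Qed.
Lemma norm1Mr (a : R) z : norm1 (a%:C * z) = `|a| * norm1 z.
Proof. by rewrite /norm1 cReM cImM /= !mul0r subr0 addr0 !normrM mulrDr. Qed.
Lemma Re_norm1 z : `|Re z| <= norm1 z. Proof. by rewrite lerDl. Qed.
Lemma Im_norm1 z : `|Im z| <= norm1 z. Proof. by rewrite lerDr. Qed.
Lemma norm1_le_normc z : norm1 z <= 2 * ComplexField.Normc.normc z.
Proof.
have h : Num.sqrt (Re z ^+ 2 + Im z ^+ 2) = ComplexField.Normc.normc z by case: z.
have hr : `|Re z| <= ComplexField.Normc.normc z.
  by rewrite -h -sqrtr_sqr ler_wsqrtr // lerDl sqr_ge0.
have hi : `|Im z| <= ComplexField.Normc.normc z.
  by rewrite -h -sqrtr_sqr ler_wsqrtr // lerDr sqr_ge0.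
by rewrite /norm1; lra.
Qed.
Lemma norm1_sum (I : Type) (r : seq I) (P : pred I) (F : I -> C) :
  norm1 (\sum_(i <- r | P i) F i) <= \sum_(i <- r | P i) norm1 (F i).
Proof.
elim/big_rec2: _ => [|i y x _ h]; first by rewrite norm10.
by rewrite (le_trans (norm1D _ _)) // lerD2l.
Qed.

End ComplexNorm.

Section ComplexCalculus.
Variable R : realType.
Local Notation C := (R[i]^o).
Implicit Types (f g u v : R -> C) (x : R).

Definition is_cderive f x (d : C) :=
  is_derive x 1 (fun y => Re (f y)) (Re d) /\ is_derive x 1 (fun y => Im (f y)) (Im d).

Lemma is_cderive_cderivable f x d : is_cderive f x d -> cderivable f x.
Proof. case=> -[h _] [h' _]; split; [exact: h|exact: h']. Qed.

Lemma is_cderive_val f x d : is_cderive f x d -> cderive f x = d.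
Proof.
move=> [[h hE] [h' hE']]; apply: complex_ext; rewrite /= derive1E //.
Qed.

Lemma cderivableP f x : cderivable f x -> is_cderive f x (cderive f x).
Proof.
move=> [h h']; rewrite /is_cderive /cderive /= !derive1E.
exact: conj (DeriveDef h erefl) (DeriveDef h' erefl).
Qed.

Lemma is_cderive_cst (c : C) x : is_cderive (fun=> c) x 0.
Proof. by split; apply: is_derive_cst. Qed.

Lemma is_cderiveD f g x d e : is_cderive f x d -> is_cderive g x e ->
  is_cderive (fun y => f y + g y) x (d + e).
Proof.
move=> [hr hi] [hr' hi']; split.
  by rewrite cReD; under eq_fun do rewrite cReD; apply: is_deriveD.
by rewrite cImD; under eq_fun do rewrite cImD; apply: is_deriveD.
Qed.

Lemma is_cderiveM f g x d e : is_cderive f x d -> is_cderive g x e ->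
  is_cderive (fun y => f y * g y) x (d * g x + f x * e).
Proof.
move=> [hr hi] [hr' hi']; split.
  under eq_fun do rewrite cReM.
  apply: (is_derive_eq (is_deriveB (is_deriveM hr hr') (is_deriveM hi hi'))).
  rewrite cReD !cReM /GRing.scale /=; ring.
under eq_fun do rewrite cImM.
apply: (is_derive_eq (is_deriveD (is_deriveM hr hi') (is_deriveM hi hr'))).
rewrite cImD !cImM /GRing.scale /=; ring.
Qed.

Lemma is_cderive_affine f (a c : R) x d : is_cderive f (a * x + c) d ->
  is_cderive (fun y => f (a * y + c)) x (a%:C * d).
Proof.
have h : is_derive x 1 (fun y : R => a * y + c) a.
  apply: (is_derive_eq (is_deriveD (is_deriveM (is_derive_cst a x 1) (is_derive_id x 1)) (is_derive_cst c x 1))).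
  rewrite /GRing.scale /=; ring.
move=> [hr hi]; split.
  apply: (is_derive_eq (@is_derive1_comp R (fun y => Re (f y)) (fun y => a * y + c) x _ _ hr h)); rewrite cReM /=; ring.
apply: (is_derive_eq (@is_derive1_comp R (fun y => Im (f y)) (fun y => a * y + c) x _ _ hi h)); rewrite cImM /=; ring.
Qed.

(** The factor 2 arises because real and imaginary parts take their mean values at different
    points. *)
Lemma cmean_value_le f f1 M : (forall x, is_cderive f x (f1 x)) ->
  forall a b, (forall x, Num.min a b <= x <= Num.max a b -> norm1 (f1 x) <= M) ->
  norm1 (f b - f a) <= 2 * M * `|b - a|.
Proof.
move=> df a b hM.
have [c /hM hc Ec] := mean_value (fun x => (df x).1) a b.
have [e /hM he Ee] := mean_value (fun x => (df x).2) a b.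
rewrite /norm1 cReD cImD cReN cImN Ec Ee !normrM -mulrDl ler_wpM2r //.
have := Re_norm1 (f1 c); have := Im_norm1 (f1 e); lra.
Qed.

Lemma cderive0_cst f : (forall x, is_cderive f x 0) -> forall x y, f x = f y.
Proof.
move=> df x y; apply/eqP; rewrite -subr_eq0; apply/eqP/norm1_eq0/eqP.
rewrite eq_le norm1_ge0 andbT.
have := @cmean_value_le f (fun=> 0) 0 df y x; rewrite mulr0 mul0r; apply => z _.
by rewrite norm10.
Qed.

End ComplexCalculus.

Section Smooth.
Variable R : realType.
Local Notation C := (R[i]^o).
Local Notation V := (@Cinf_circle R).
Implicit Types (f g u v : R -> C) (x : R).

(** A coinduction principle in place of formulas for iterated derivatives: each use only has to
    exhibit a class of functions stable under [cderive]. *)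
Lemma Cinf_coind (P : (R -> C) -> Prop) :
  (forall f, P f -> [/\ forall x, f (x + 2 * pi) = f x, forall x, cderivable f x &
                        P (cderive f)]) ->
  forall f, P f -> V f.
Proof.
move=> hP f Pf; split; first by have [] := hP _ Pf.
move=> k; elim: k f Pf => [|k IH] f Pf x; first by have [] := hP _ Pf.
by rewrite iterSr; apply: IH; have [] := hP _ Pf.
Qed.

Lemma Cinf_periodic u x : V u -> u (x + 2 * pi) = u x. Proof. by case. Qed.
Lemma Cinf_cderivable u x : V u -> cderivable u x. Proof. by case=> _ /(_ 0%N x). Qed.
Lemma Cinf_is_cderive u x : V u -> is_cderive u x (cderive u x).
Proof. by move=> Vu; apply: cderivableP; exact: Cinf_cderivable. Qed.

Lemma is_cderive_shift f (c : R) x d : is_cderive f (x + c) d ->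
  is_cderive (fun y => f (y + c)) x d.
Proof.
move=> h; have := @is_cderive_affine R f 1 c x d; rewrite mul1r mul1r => /(_ h).
by under eq_fun do rewrite mul1r.
Qed.

Lemma Cinf_cderive u : V u -> V (cderive u).
Proof.
move=> Vu; split; last by move=> k x; rewrite -iterSr; exact: Vu.2.
move=> x; rewrite -(is_cderive_val (is_cderive_shift (Cinf_is_cderive (x + 2 * pi) Vu))).
by congr (cderive _ x); apply/funext => y; exact: Cinf_periodic.
Qed.

Lemma Cinf_iter_cderive u k : V u -> V (iter k (@cderive R) u).
Proof. by move=> Vu; elim: k => [|k IH]; [exact: Vu|exact: Cinf_cderive IH]. Qed.

Lemma cderive_shift u (c : R) : V u -> cderive (fun y => u (y + c)) = fun y => cderive u (y + c).
Proof.
by move=> Vu; apply/funext => x; apply/is_cderive_val/is_cderive_shift/Cinf_is_cderive.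
Qed.

Lemma cderiveD u v : V u -> V v -> cderive (u + v) = cderive u + cderive v.
Proof.
by move=> Vu Vv; apply/funext => x; apply/is_cderive_val/is_cderiveD; exact: Cinf_is_cderive.
Qed.

Lemma cderiveM u v : V u -> V v ->
  cderive (fun x => u x * v x) = (fun x => cderive u x * v x) + (fun x => u x * cderive v x).
Proof.
by move=> Vu Vv; apply/funext => x; apply/is_cderive_val/is_cderiveM; exact: Cinf_is_cderive.
Qed.

Lemma cderive_cst (c : C) : cderive (fun=> c) = 0.
Proof. by apply/funext => x; apply/is_cderive_val/is_cderive_cst. Qed.

Lemma cderiveZ (c : C) u : V u -> cderive (c *: u) = c *: cderive u.
Proof.
move=> Vu; apply/funext => x; apply/is_cderive_val.
have := is_cderiveM (is_cderive_cst c x) (Cinf_is_cderive x Vu).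
by rewrite mul0r add0r.
Qed.

Lemma Cinf_cst (c : C) : V (fun=> c).
Proof.
apply: (@Cinf_coind (fun f => exists c, f = fun=> c)); last by exists c.
move=> _ [{}c ->]; split=> [x|x|]; last by exists 0; rewrite cderive_cst.
  by [].
exact: is_cderive_cderivable (is_cderive_cst c x).
Qed.

Lemma Cinf_subspace : is_subspace V.
Proof.
split; first exact: (Cinf_cst 0).
move=> a u v Vu Vv.
apply: (@Cinf_coind (fun f => exists u v, [/\ V u, V v & f = a *: u + v])); last by exists u, v.
move=> _ [{Vu Vv}u [{}v [Vu Vv ->]]].
have h x : is_cderive (a *: u + v) x (a * cderive u x + cderive v x).
  apply: is_cderiveD; last exact: Cinf_is_cderive.
  have := is_cderiveM (is_cderive_cst a x) (Cinf_is_cderive x Vu).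
  by rewrite mul0r add0r.
split=> [x|x|].
- rewrite -[LHS]/(a * u (x + 2 * pi) + v (x + 2 * pi)).
  by rewrite !Cinf_periodic.
- exact: is_cderive_cderivable (h x).
- exists (cderive u), (cderive v); split; try exact: Cinf_cderive.
  by apply/funext => x; rewrite (is_cderive_val (h x)).
Qed.

Lemma Cinf_shift u c : V u -> V (fun x => u (x + c)).
Proof.
move=> Vu; apply: (@Cinf_coind (fun f => exists2 u, V u & f = fun x => u (x + c))); last by exists u.
move=> _ [{Vu}u Vu ->]; split=> [x|x|].
- by rewrite addrAC Cinf_periodic.
- exact: is_cderive_cderivable (is_cderive_shift (Cinf_is_cderive _ Vu)).
- by exists (cderive u); [exact: Cinf_cderive|rewrite cderive_shift].
Qed.

(** Products alone are not stable under [cderive]; their finite sums are, by the Leibniz rule, and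
    so form a class to which [Cinf_coind] applies. *)
Inductive sum_of_products : (R -> C) -> Prop :=
| product_of u v : V u -> V v -> sum_of_products (fun x => u x * v x)
| sum_of f g : sum_of_products f -> sum_of_products g -> sum_of_products (f + g).

Lemma CinfM u v : V u -> V v -> V (fun x => u x * v x).
Proof.
move=> Vu Vv; apply: (@Cinf_coind sum_of_products); last exact: product_of.
move=> f; elim=> [{Vu Vv}u {}v Vu Vv|{}f g _ [fp fd fc] _ [gp gd gc]].
  split=> [x|x|]; first by rewrite !Cinf_periodic.
    by apply: is_cderive_cderivable; apply: is_cderiveM; exact: Cinf_is_cderive.
  rewrite (cderiveM Vu Vv); apply: sum_of.
    exact: product_of (Cinf_cderive Vu) Vv.
  exact: product_of Vu (Cinf_cderive Vv).
have h x : is_cderive (f + g) x (cderive f x + cderive g x).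
  by apply: is_cderiveD; exact: cderivableP.
split=> [x|x|].
- by rewrite -[LHS]/(f (x + 2 * pi) + g (x + 2 * pi)) fp gp.
- exact: is_cderive_cderivable (h x).
- rewrite (_ : cderive _ = cderive f + cderive g); first exact: sum_of.
  by apply/funext => x; rewrite (is_cderive_val (h x)).
Qed.

Lemma linear_endo_cderive : linear_endo V (@cderive R).
Proof.
split=> [u|a u v Vu Vv]; first exact: Cinf_cderive.
by rewrite (cderiveD (subspaceZ a Cinf_subspace Vu) Vv) (cderiveZ a Vu).
Qed.

End Smooth.

(** * Summable families of complex numbers *)

Section ComplexSums.
Variables (R : realType) (I : choiceType).
Local Notation C := (R[i]^o).
Implicit Types (f g : I -> C) (w : I -> R).

Definition csummable f := abs_summable (fun i => norm1 (f i)).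

Lemma csummable_dom (M : R) w f : abs_summable w -> (forall i, norm1 (f i) <= M * w i) ->
  csummable f.
Proof.
move=> sw h; apply: (@abs_summable_dom _ _ M _ _ sw) => i.
by rewrite ger0_norm ?norm1_ge0.
Qed.

Lemma csummable_Re f : csummable f -> abs_summable (fun i => Re (f i)).
Proof.
by apply: abs_summable_le => i; rewrite (ger0_norm (norm1_ge0 _)) Re_norm1.
Qed.

Lemma csummable_Im f : csummable f -> abs_summable (fun i => Im (f i)).
Proof.
by apply: abs_summable_le => i; rewrite (ger0_norm (norm1_ge0 _)) Im_norm1.
Qed.

Lemma csummableD f g : csummable f -> csummable g -> csummable (fun i => f i + g i).
Proof.
move=> sf sg; apply: abs_summable_le (abs_summableD sf sg) => i.
by rewrite !ger0_norm ?norm1D ?addr_ge0 ?norm1_ge0.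
Qed.

Lemma csummableM (c : C) f : csummable f -> csummable (fun i => c * f i).
Proof.
move=> sf; apply: abs_summable_le (abs_summableZ (norm1 c) sf) => i.
by rewrite !ger0_norm ?norm1M ?mulr_ge0 ?norm1_ge0.
Qed.

Lemma eq_csum f g : f =1 g -> csum f = csum g.
Proof. by move=> /funext ->. Qed.

Lemma csumD f g : csummable f -> csummable g ->
  csum (fun i => f i + g i) = csum f + csum g.
Proof.
move=> sf sg; apply: complex_ext; rewrite ?cReD ?cImD /=.
  under eq_rsum do rewrite cReD; apply: rsumD; exact: csummable_Re.
under eq_rsum do rewrite cImD; apply: rsumD; exact: csummable_Im.
Qed.

Lemma csumM (c : C) f : csummable f -> csum (fun i => c * f i) = c * csum f.
Proof.
move=> sf; have [sr si] := (csummable_Re sf, csummable_Im sf).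
apply: complex_ext; rewrite ?cReM ?cImM /=.
  under eq_rsum do rewrite cReM; rewrite rsumD ?rsumN ?rsumZ //; first exact: abs_summableZ.
  by apply: abs_summableN; exact: abs_summableZ.
by under eq_rsum do rewrite cImM; rewrite rsumD ?rsumZ //; exact: abs_summableZ.
Qed.

Lemma csum_norm1_le (M : R) w f : abs_summable w -> (forall i, norm1 (f i) <= M * w i) ->
  norm1 (csum f) <= 2 * M * rsum w.
Proof.
move=> sw h; rewrite -mulrA mulr_natl mulr2n /norm1 lerD //=; apply: rsum_norm_le => // i;
  apply: le_trans (h i); [exact: Re_norm1|exact: Im_norm1].
Qed.

Lemma csum_delta (i0 : I) (a : C) : csum (fun i => if i == i0 then a else 0) = a.
Proof.
apply: complex_ext => /=.
  by under eq_rsum do rewrite (fun_if (@complex.Re R)); exact: rsum_delta.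
by under eq_rsum do rewrite (fun_if (@complex.Im R)); exact: rsum_delta.
Qed.

Lemma csum_sum (J : Type) (r : seq J) (P : pred J) (F : J -> I -> C) :
  (forall j, P j -> csummable (F j)) ->
  csummable (fun i => \sum_(j <- r | P j) F j i) /\
  csum (fun i => \sum_(j <- r | P j) F j i) = \sum_(j <- r | P j) csum (F j).
Proof.
move=> sF; elim: r => [|j r [IHs IH]].
  rewrite big_nil; under eq_fun do rewrite big_nil; split.
    by rewrite /csummable /abs_summable esum1 // => i _; rewrite norm10 normr0.
  by rewrite /csum /= rsum0.
rewrite big_cons; under eq_fun do rewrite big_cons.
case: ifP => // Pj; split; first by apply: csummableD => //; exact: sF.
by rewrite csumD ?IH //; exact: sF.
Qed.

End ComplexSums.

Lemma reindex_csum (R : realType) (I J : choiceType) (e : I -> J) (f : J -> R[i]^o) :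
  bijective e -> csum (fun i => f (e i)) = csum f.
Proof.
move=> be; apply: complex_ext => /=.
  by rewrite -(reindex_rsum (fun j => Re (f j)) be).
by rewrite -(reindex_rsum (fun j => Im (f j)) be).
Qed.

Lemma csum_fubini (R : realType) (I J : choiceType) (f : I * J -> R[i]^o) :
  csummable f -> csum (fun i => csum (fun j => f (i, j))) = csum f.
Proof.
move=> sf; apply: complex_ext => /=.
  by have [_ <-] := rsum_fubini (csummable_Re sf).
by have [_ <-] := rsum_fubini (csummable_Im sf).
Qed.

(** * Bounds in the C^j norms and smooth series *)

Section Bounds.
Variable R : realType.
Local Notation C := (R[i]^o).
Local Notation V := (@Cinf_circle R).
Implicit Types (f g u v : R -> C) (x : R).

(** The C^j norm enters only through its upper bounds, so that no supremum over the circle is ever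
    formed. *)
Definition bnd (j : nat) u (M : R) :=
  forall (i : nat) x, (i <= j)%N -> norm1 (iter i (@cderive R) u x) <= M.

Lemma bnd_val j u M : bnd j u M -> forall x, norm1 (u x) <= M.
Proof. by move=> h x; exact: (h 0%N). Qed.

Lemma bnd_ge0 j u M : bnd j u M -> 0 <= M.
Proof. by move=> h; apply: le_trans (bnd_val h 0); exact: norm1_ge0. Qed.

Lemma bnd_cderive j u M : bnd j.+1 u M -> bnd j (cderive u) M.
Proof. by move=> h i x ij; rewrite -iterSr; exact: h. Qed.

Lemma bndS j u M : (forall x, norm1 (u x) <= M) -> bnd j (cderive u) M -> bnd j.+1 u M.
Proof. by move=> h h' [|i] x ij; [exact: h|rewrite iterSr; exact: h']. Qed.

Lemma bnd0 u M : (forall x, norm1 (u x) <= M) -> bnd 0 u M.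
Proof. by move=> h [|i] x //; exact: h. Qed.

Lemma bnd_le j u M N : M <= N -> bnd j u M -> bnd j u N.
Proof. by move=> MN h i x ij; exact: le_trans (h _ _ ij) MN. Qed.

Lemma bnd_ord j k u M : (j <= k)%N -> bnd k u M -> bnd j u M.
Proof. by move=> jk h i x ij; apply: h; exact: leq_trans jk. Qed.

Lemma bndD j u v M N : V u -> V v -> bnd j u M -> bnd j v N -> bnd j (u + v) (M + N).
Proof.
move=> Vu Vv hu hv i x ij.
have -> : iter i (@cderive R) (u + v) = iter i (@cderive R) u + iter i (@cderive R) v.
  elim: i {ij} => // i IH; rewrite !iterS IH.
  exact: cderiveD (Cinf_iter_cderive i Vu) (Cinf_iter_cderive i Vv).
by apply: le_trans (norm1D _ _) _; rewrite lerD ?hu ?hv.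
Qed.

(** Each use of the Leibniz rule doubles the number of terms, hence [2 ^+ j]. *)
Lemma bndM j u v M N : V u -> V v -> bnd j u M -> bnd j v N ->
  bnd j (fun x => u x * v x) (2 ^+ j * (M * N)).
Proof.
elim: j u v => [|j IH] u v Vu Vv hu hv.
  apply: bnd0 => x; rewrite mul1r (le_trans (norm1M _ _)) //.
  by rewrite ler_pM ?norm1_ge0 ?(bnd_val hu) ?(bnd_val hv).
have [Vu' Vv'] := (Cinf_cderive Vu, Cinf_cderive Vv).
have M0 := bnd_ge0 hu; have N0 := bnd_ge0 hv.
apply: bndS => [x|].
  apply: le_trans (norm1M _ _) _.
  apply: (@le_trans _ _ (M * N)).
    by rewrite ler_pM ?norm1_ge0 ?(bnd_val hu) ?(bnd_val hv).
  by rewrite ler_peMl ?mulr_ge0 // exprn_ege1 // ler1n.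
rewrite (cderiveM Vu Vv) exprS -mulrA mulr_natl mulr2n.
apply: bndD; [exact: CinfM|exact: CinfM| |].
  by apply: IH => //; [exact: bnd_cderive|apply: bnd_ord hv; exact: leqnSn].
by apply: IH => //; [apply: bnd_ord hu; exact: leqnSn|exact: bnd_cderive].
Qed.

Lemma bnd_shift j u M c : V u -> bnd j u M -> bnd j (fun x => u (x + c)) M.
Proof.
move=> Vu h i x ij.
have -> : iter i (@cderive R) (fun x => u (x + c)) = fun x => iter i (@cderive R) u (x + c).
  elim: i {ij} => // i IH; rewrite !iterS IH; exact: cderive_shift (Cinf_iter_cderive i Vu).
exact: h.
Qed.

Lemma bnd_cst j (c : C) : bnd j (fun=> c) (norm1 c).
Proof.
case: j => [|j]; first by apply: bnd0.
apply: bndS => // i x _; rewrite cderive_cst.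
suff -> : iter i (@cderive R) 0 = 0 by rewrite [norm1 _]norm10 norm1_ge0.
by elim: i => // i IH; rewrite iterS IH; exact: cderive_cst.
Qed.

Lemma bndZ j (c : C) u M : V u -> bnd j u M -> bnd j (c *: u) (norm1 c * M).
Proof.
move=> Vu h i x ij.
have -> : iter i (@cderive R) (c *: u) = c *: iter i (@cderive R) u.
  elim: i {ij} => // i IH; rewrite !iterS IH; exact: cderiveZ (Cinf_iter_cderive i Vu).
apply: le_trans (norm1M _ _) _; rewrite ler_wpM2l ?norm1_ge0 //; exact: h.
Qed.

Lemma periodicZ (T : Type) (f : R -> T) (k : int) :
  (forall x, f (x + 2 * pi) = f x) -> forall x, f (x + k%:~R * (2 * pi)) = f x.
Proof.
move=> fp; have pn (n : nat) x : f (x + n%:R * (2 * pi)) = f x.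
  elim: n x => [|n IH] x; first by rewrite mul0r addr0.
  by rewrite -natr1 mulrDl mul1r addrA fp IH.
case: k => n x; first exact: pn.
have -> : (Negz n)%:~R = - n.+1%:R :> R by rewrite NegzE mulrNz.
by rewrite mulNr -[LHS](pn n.+1) subrK.
Qed.

Lemma reduce_mod_2pi (a x : R) : exists k : int, a <= x + k%:~R * (2 * pi) < a + 2 * pi.
Proof.
have p0 : 0 < 2 * pi :> R by rewrite mulr_gt0 // pi_gt0.
exists (- Num.floor ((x - a) / (2 * pi))).
have /andP[h1 h2] := floor_itv ((x - a) / (2 * pi)).
rewrite ler_pdivlMr // in h1; rewrite ltr_pdivrMr // intrD mulrDl mul1r in h2.
by rewrite mulrNz mulNr; lra.
Qed.

Lemma periodic_bounded (f : R -> R) : (forall x, f (x + 2 * pi) = f x) ->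
  continuous f -> exists M, forall x, `|f x| <= M.
Proof.
move=> fp fc; have p0 : 0 <= 2 * pi :> R by rewrite mulr_ge0 // pi_ge0.
have [c _ hc] := EVT_max p0 (continuous_subspaceT fc).
have [d _ hd] := EVT_min p0 (continuous_subspaceT fc).
exists (`|f c| + `|f d|) => x.
have [k /andP[k1 k2]] := reduce_mod_2pi 0 x.
have kI : x + k%:~R * (2 * pi) \in `[0, 2 * pi].
  by rewrite in_itv /= k1 /= ltW // (lt_le_trans k2) // add0r.
have := hc _ kI; have := hd _ kI; rewrite !(periodicZ k fp).
by case: (ger0P (f c)); case: (ger0P (f d)); case: (ger0P (f x)); lra.
Qed.

Lemma Cinf_bounded u : V u -> exists M, forall x, norm1 (u x) <= M.
Proof.
move=> Vu.
have cr : continuous (fun x => Re (u x)).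
  by move=> x; exact: is_derive_continuous (Cinf_is_cderive x Vu).1.
have ci : continuous (fun x => Im (u x)).
  by move=> x; exact: is_derive_continuous (Cinf_is_cderive x Vu).2.
have [|M hM] := periodic_bounded _ cr; first by move=> x; rewrite Cinf_periodic.
have [|N hN] := periodic_bounded _ ci; first by move=> x; rewrite Cinf_periodic.
by exists (M + N) => x; rewrite lerD.
Qed.

Lemma Cinf_bnd j u : V u -> exists M, bnd j u M.
Proof.
elim: j u => [|j IH] u Vu; have [M hM] := Cinf_bounded Vu.
  by exists M; exact: bnd0.
have [N hN] := IH _ (Cinf_cderive Vu).
exists (Num.max M N); apply: bndS; first by move=> x; rewrite le_max hM.
by apply: bnd_le hN; rewrite le_max lexx orbT.
Qed.

Section SmoothSeries.
Variables (I : choiceType) (w : I -> R).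
Hypothesis sw : abs_summable w.

(** One weight serves all orders and only the constant depends on [j], which is stable under
    termwise differentiation. Leaving [I] and [w] general covers both the families over Z^n and the
    Neumann series. *)
Definition smooth_family (f : I -> R -> C) :=
  (forall i, V (f i)) /\ forall j, exists M, forall i, bnd j (f i) (M * w i).

Lemma smooth_family_csummable (f : I -> R -> C) x : smooth_family f -> csummable (f^~ x).
Proof.
case=> Vf /(_ 0%N)[M hM]; apply: (@csummable_dom _ _ M _ _ sw) => i.
exact: (bnd_val (hM i)).
Qed.

Lemma is_cderive_csum (f : I -> R -> C) x : smooth_family f ->
  is_cderive (fun x => csum (f^~ x)) x (csum (fun i => cderive (f i) x)).
Proof.
move=> [Vf /(_ 2%N)[M hM]].
have Vf' i := Cinf_cderive (Vf i); have Vf'' i := Cinf_cderive (Vf' i).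
have b0 i y : norm1 (f i y) <= M * w i by apply: (hM i 0%N).
have b1 i y : norm1 (cderive (f i) y) <= M * w i by apply: (hM i 1%N).
have b2 i y : norm1 (cderive (cderive (f i)) y) <= M * w i by apply: (hM i 2%N).
split.
apply: (@is_derive_rsum R I (fun i y => Re (f i y)) (fun i y => Re (cderive (f i) y))
    (fun i y => Re (cderive (cderive (f i)) y)) M w sw) => [i y|i y|i y].
- exact: (Cinf_is_cderive y (Vf i)).1.
- exact: (Cinf_is_cderive y (Vf' i)).1.
- by split; apply: le_trans (Re_norm1 _) _.
apply: (@is_derive_rsum R I (fun i y => Im (f i y)) (fun i y => Im (cderive (f i) y))
    (fun i y => Im (cderive (cderive (f i)) y)) M w sw) => [i y|i y|i y].
- exact: (Cinf_is_cderive y (Vf i)).2.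
- exact: (Cinf_is_cderive y (Vf' i)).2.
- by split; apply: le_trans (Im_norm1 _) _.
Qed.

Lemma smooth_family_cderive (f : I -> R -> C) : smooth_family f -> smooth_family (fun i => cderive (f i)).
Proof.
move=> [Vf hf]; split=> [i|j]; first exact: Cinf_cderive.
have [M hM] := hf j.+1; exists M => i; exact: bnd_cderive.
Qed.

Lemma cderive_csum (f : I -> R -> C) : smooth_family f ->
  cderive (fun x => csum (f^~ x)) = fun x => csum (fun i => cderive (f i) x).
Proof. by move=> hf; apply/funext => x; exact/is_cderive_val/is_cderive_csum. Qed.

Lemma Cinf_csum (f : I -> R -> C) : smooth_family f -> V (fun x => csum (f^~ x)).
Proof.
move=> sf; apply: (@Cinf_coind _ (fun g => exists2 f : I -> R -> C, smooth_family f & g = fun x => csum (f^~ x)));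
  last by exists f.
move=> _ [{sf}f sf ->]; split=> [x|x|].
- by apply: eq_csum => i; apply: Cinf_periodic; exact: sf.1.
- exact: is_cderive_cderivable (is_cderive_csum x sf).
- by exists (fun i => cderive (f i)); [exact: smooth_family_cderive|rewrite cderive_csum].
Qed.

Lemma bnd_csum j (f : I -> R -> C) M : smooth_family f -> (forall i, bnd j (f i) (M * w i)) ->
  bnd j (fun x => csum (f^~ x)) (2 * M * rsum w).
Proof.
elim: j f => [|j IH] f sf hf.
  by apply: bnd0 => x; apply: csum_norm1_le => // i; exact: bnd_val (hf i) x.
apply: bndS => [x|]; first by apply: csum_norm1_le => // i; exact: bnd_val (hf i) x.
rewrite (cderive_csum sf); apply: IH; first exact: smooth_family_cderive.
by move=> i; exact: bnd_cderive.
Qed.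

End SmoothSeries.
End Bounds.

(** * The crossed product and its action *)

Section Weights.
Variable R : realType.

Lemma abs_summable_nat (a : nat -> R) (B : R) : (forall i, 0 <= a i) ->
  (forall N, \sum_(i < N) a i <= B) -> abs_summable a.
Proof.
move=> a0 hB; rewrite /abs_summable -nneseries_esumT; last by move=> i; rewrite lee_fin.
apply: (@le_lt_trans _ _ B%:E); last exact: ltry.
apply: (lime_le (is_cvg_nneseries_cond _)) => [i _|]; first by rewrite lee_fin.
apply: nearW => N; rewrite sumEFin lee_fin big_mkord (le_trans _ (hB N)) //.
by apply: ler_sum => i _; rewrite ger0_norm.
Qed.

Lemma abs_summable_geometric : abs_summable (fun i : nat => (2^-1 : R) ^+ i).
Proof.
apply: (@abs_summable_nat _ 2) => [i|N]; first by rewrite exprn_ge0 // invr_ge0.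
suff -> : \sum_(i < N) (2^-1 : R) ^+ i = 2 - 2 * 2^-1 ^+ N.
  by rewrite gerBl mulr_ge0 // exprn_ge0 // invr_ge0.
elim: N => [|N IH]; first by rewrite big_ord0 expr0 mulr1 subrr.
rewrite big_ord_recr /= IH exprS; lra.
Qed.

Definition weight1 (k : int) : R := ((1 + `|k%:~R|) ^+ 2)^-1.

Lemma weight1_ge0 k : 0 <= weight1 k.
Proof. by rewrite invr_ge0 exprn_ge0 // addr_ge0. Qed.

Lemma abs_summable_weight1 : abs_summable weight1.
Proof.
pose a (i : nat) : R := ((i.+1%:R) ^+ 2)^-1.
have a0 i : 0 <= a i by rewrite invr_ge0 exprn_ge0.
have sa : abs_summable a.
  apply: (@abs_summable_nat _ 2) => // N.
  (* Telescoping: [1 / t^2 <= 2 / t - 2 / (t + 1)] for [t = N + 1 >= 1]. *)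
  suff : \sum_(i < N) a i <= 2 - 2 / N.+1%:R.
    by move/le_trans; apply; rewrite gerBl divr_ge0.
  elim: N => [|N IH]; first by rewrite big_ord0 divr1 subrr.
  rewrite big_ord_recr /=; apply: (le_trans (lerD IH (lexx _))).
  rewrite /a -[N.+2%:R]natr1; have : 1 <= N.+1%:R :> R by rewrite ler1n.
  move: (N.+1%:R) => {IH} t t1.
  have t0 : 0 < t by lra.
  have t2 : 0 < t + 1 by lra.
  rewrite -subr_ge0 [leRHS](_ : _ = (t - 1) / (t ^+ 2 * (t + 1))); last first.
    by field; rewrite (gt_eqF t0) (gt_eqF t2).
  by rewrite divr_ge0 ?subr_ge0 // mulr_ge0 ?exprn_ge0 // ltW.
have sb : abs_summable (fun _ : bool => 1 : R).
  by apply: (@abs_summable_finite _ _ _ [:: true; false]) => -[].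
have sp := abs_summable_prod sb sa.
(* The integers are two copies of the naturals; [Negz i] is [-(i + 1)], whose weight [1 / (i + 2)^2]
   lies below [a i]. *)
pose e (k : int) := match k with Posz i => (true, i) | Negz i => (false, i) end.
have be : bijective e.
  exists (fun p : bool * nat => if p.1 then Posz p.2 else Negz p.2); first by case.
  by case=> -[].
apply: abs_summable_le (reindex_abs_summable be sp) => k.
rewrite !ger0_norm ?weight1_ge0 ?mulr_ge0 //= mul1r /weight1 /a.
case: k => i /=; rewrite lef_pV2 ?posrE ?exprn_gt0 ?ltr_pwDl // ler_pXn2r ?nnegrE ?addr_ge0 //.
  by rewrite ger0_norm // -natr1 addrC.
rewrite NegzE mulrNz normrN ger0_norm //.
by rewrite [leRHS]addrC natr1 ler_nat.
Qed.

(** A product over the coordinates, rather than a power of [1 + absZn], is summable by induction on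
    [n], without counting lattice points of given size. *)
Definition weight n (g : 'rV[int]_n) : R := \prod_i weight1 (g 0 i).

Lemma weight_ge0 n (g : 'rV[int]_n) : 0 <= weight g.
Proof. by apply: prodr_ge0 => i _; exact: weight1_ge0. Qed.

Lemma weight1_le1 k : weight1 k <= 1.
Proof. by rewrite invf_le1 ?exprn_gt0 ?ltr_pwDl // exprn_ege1 // lerDl. Qed.

Lemma weight_le1 n (g : 'rV[int]_n) : weight g <= 1.
Proof. by apply: prodr_ile1 => i _; rewrite weight1_ge0 weight1_le1. Qed.

Lemma abs_summable_weight n : abs_summable (@weight n).
Proof.
elim: n => [|n IH].
  by apply: (@abs_summable_finite _ _ _ [:: 0]) => g; rewrite inE thinmx0 eqxx.
pose e (g : 'rV[int]_n.+1) := (g 0 ord0, \row_i g 0 (lift ord0 i)).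
have be : bijective e.
  exists (fun p : int * 'rV[int]_n =>
    \row_i (if unlift ord0 i is Some j then p.2 0 j else p.1)).
    move=> g; apply/rowP => i; rewrite mxE; case: unliftP => [j ->|->] //=.
    by rewrite mxE.
  move=> [k g]; rewrite /e; congr (_, _); first by rewrite mxE unlift_none.
  by apply/rowP => i; rewrite !mxE liftK.
apply: abs_summable_le (reindex_abs_summable be (abs_summable_prod abs_summable_weight1 IH)) => g.
rewrite /weight big_ord_recl /=.
by under [X in _ <= `|_ * X|]eq_bigr do rewrite mxE.
Qed.

(** Each factor [1 + |g_i|] is at most [1 + absZn R g]. The exponent [2 * n] is the order of decay
    that [in_crossed_smooth] extracts. *)
Lemma weight_absZn n (g : 'rV[int]_n) : 1 <= weight g * (1 + absZn R g) ^+ (2 * n).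
Proof.
have a0 i : 0 <= 1 + `|(g 0 i)%:~R| :> R by rewrite addr_ge0.
have ai i : 1 + `|(g 0 i)%:~R| <= 1 + absZn R g.
  by rewrite lerD2l /absZn (bigD1 i) //= lerDl sumr_ge0.
have -> : (1 + absZn R g) ^+ (2 * n) = \prod_(i < n) (1 + absZn R g) ^+ 2.
  by rewrite prodr_const card_ord exprM.
rewrite /weight -big_split /=; elim/big_ind: _ => [//|x y|i _]; first exact: mulr_ege1.
rewrite /weight1 mulrC ler_pdivlMr ?exprn_gt0 ?ltr_pwDl // mul1r.
by rewrite ler_pXn2r ?nnegrE // (le_trans (a0 i)).
Qed.

Lemma in_crossed_smooth n (f : 'rV[int]_n -> R -> R[i]^o) :
  in_crossed f -> smooth_family (@weight n) f.
Proof.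
move=> [Vf hf]; split=> // j; have [M hM] := hf j (2 * n)%N.
exists (2 * M) => g i x ij; apply: le_trans (norm1_le_normc _) _.
rewrite -mulrA ler_wpM2l //.
set N := ComplexField.Normc.normc _.
have N0 : 0 <= N by rewrite /N; case: (iter _ _ _ _) => ? ?; exact: sqrtr_ge0.
apply: (@le_trans _ _ (N * (weight g * (1 + absZn R g) ^+ (2 * n)))).
  by rewrite ler_peMr // weight_absZn.
by rewrite mulrCA mulrC ler_wpM2r ?weight_ge0 // hM.
Qed.

End Weights.

Local Opaque Cinf_circle cderive.

(** * Operators bounded in every C^j norm *)

Section BoundedOperators.
Variable R : realType.
Local Notation C := (R[i]^o).
Local Notation V := (@Cinf_circle R).
Implicit Types (A B : (R -> C) -> R -> C) (u v : R -> C).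

(** [r] counts the derivatives gained. The constant may depend on [j], so a small bound at order 0
    says nothing about the bounds at higher orders. *)
Definition bounded_op (r : nat) A := linear_endo V A /\
  forall j, exists2 c, 0 <= c & forall u M, V u -> bnd j u M -> bnd (j + r) (A u) (c * M).

Lemma bounded_op_comp r s A B : bounded_op r A -> bounded_op s B ->
  bounded_op (s + r) (A \o B).
Proof.
move=> [lA hA] [lB hB]; split; first exact: linear_endo_comp.
move=> j; have [c c0 hc] := hB j; have [d d0 hd] := hA (j + s)%N.
exists (d * c); first exact: mulr_ge0.
move=> u M Vu hu; rewrite addnA -mulrA; apply: hd; first exact: lB.1.
exact: hc.
Qed.

Lemma bounded_op_weaken r A : bounded_op r A -> bounded_op 0 A.
Proof.
move=> [lA hA]; split=> // j; have [c c0 hc] := hA j; exists c => // u M Vu hu.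
by apply: bnd_ord (hc _ _ Vu hu); rewrite addn0 leq_addr.
Qed.

Lemma bounded_op_id : bounded_op 0 id.
Proof.
split; first exact: linear_endo_id.
by move=> j; exists 1 => // u M Vu hu; rewrite addn0 mul1r.
Qed.

Lemma bounded_op_add r A B : bounded_op r A -> bounded_op r B ->
  bounded_op r (fun u => A u + B u).
Proof.
move=> [lA hA] [lB hB]; split; first exact: linear_endo_add (Cinf_subspace R) _ _ lA lB.
move=> j; have [c c0 hc] := hA j; have [d d0 hd] := hB j.
exists (c + d); first exact: addr_ge0.
move=> u M Vu hu; rewrite mulrDl.
apply: bndD; [exact: lA.1|exact: lB.1|exact: hc|exact: hd].
Qed.

Lemma bounded_op_scale r (a : C) A : bounded_op r A -> bounded_op r (fun u => a *: A u).
Proof.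
move=> [lA hA]; split; first exact: linear_endo_scale (Cinf_subspace R) _ _ lA.
move=> j; have [c c0 hc] := hA j.
exists (norm1 a * c); first by rewrite mulr_ge0 ?norm1_ge0.
move=> u M Vu hu; rewrite -mulrA; apply: bndZ; first exact: lA.1.
exact: hc.
Qed.

Lemma bounded_op0 : bounded_op 0 (fun=> 0).
Proof.
have V0 := (Cinf_subspace R).1; split.
  by split=> [u _|a u v _ _]; [exact: V0|rewrite scaler0 addr0].
move=> j; exists 0 => // u M _ _; rewrite mul0r addn0.
by have := @bnd_cst R j 0; rewrite norm10.
Qed.

Lemma bounded_op_sum (I : Type) (s : seq I) (P : pred I) (A : I -> (R -> C) -> R -> C) :
  (forall i, P i -> bounded_op 0 (A i)) ->
  bounded_op 0 (fun u => \sum_(i <- s | P i) A i u).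
Proof.
move=> hA; elim: s => [|i s IH].
  by under eq_fun do rewrite big_nil; exact: bounded_op0.
have [Pi|nPi] := boolP (P i).
  by under eq_fun do rewrite big_cons Pi; exact: bounded_op_add (hA _ Pi) IH.
by under eq_fun do rewrite big_cons (negPf nPi).
Qed.

Lemma bounded_op_iter A k : bounded_op 0 A -> bounded_op 0 (iter k A).
Proof.
move=> hA; elim: k => [|k IH]; first exact: bounded_op_id.
exact: bounded_op_comp hA IH.
Qed.

End BoundedOperators.

Section CrossedProduct.
Variables (R : realType) (n : nat) (alpha : 'rV[R]_n).
Local Notation C := (R[i]^o).
Local Notation V := (@Cinf_circle R).
Local Notation Zn := 'rV[int]_n.
Local Notation ang := (angle alpha).
Local Notation w := (@weight R n).
Implicit Types (f : Zn -> R -> C) (u v : R -> C) (x : R).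

Lemma angleD (g h : Zn) : ang (g + h) = ang g + ang h.
Proof.
rewrite /angle -big_split; apply: eq_bigr => i _ /=.
by rewrite mxE intrD mulrDl.
Qed.

Lemma angleB (g h : Zn) : ang (g - h) = ang g - ang h.
Proof. by have := angleD (g - h) h; rewrite subrK => ->; rewrite addrK. Qed.

Lemma angle0 : ang 0 = 0.
Proof. by have := angleB 0 0; rewrite subr0 subrr. Qed.

(** The operator [sum_g T(g) f(g)] by which a family acts on functions; [D] is assembled from
    these. *)
Definition crossed_op f u x := csum (fun g => f g (x - ang g) * u (x - ang g)).

Lemma smooth_family_op f u : smooth_family w f -> V u ->
  smooth_family w (fun g x => f g (x - ang g) * u (x - ang g)).
Proof.
move=> [Vf hf] Vu; split=> [g|j].
  exact: Cinf_shift (- ang g) (CinfM (Vf g) Vu).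
have [M hM] := hf j; have [N hN] := Cinf_bnd j Vu.
exists (2 ^+ j * (M * N)) => g; apply: (bnd_shift (- ang g) (CinfM (Vf g) Vu)).
have := bndM (Vf g) Vu (hM g) hN; apply: bnd_le.
by rewrite le_eqVlt; apply/orP; left; apply/eqP; ring.
Qed.

Lemma bounded_op_crossed f : smooth_family w f -> bounded_op 0 (crossed_op f).
Proof.
move=> sf; have sw := abs_summable_weight R n; split; first split=> [u Vu|a u v Vu Vv].
- exact: (Cinf_csum sw (smooth_family_op sf Vu)).
- apply/funext => x; rewrite /crossed_op.
  have su := smooth_family_csummable sw x (smooth_family_op sf Vu).
  have sv := smooth_family_csummable sw x (smooth_family_op sf Vv).
  rewrite -[RHS]/(a * csum _ + csum _) -csumM // -csumD //; last exact: csummableM.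
  apply: eq_csum => g; rewrite -[(a *: u + v) _]/(a * u _ + v _).
  by rewrite mulrDr mulrCA.
- move=> j; have [M' hM'] := sf.2 j; pose M := `|M'|.
  have hM g : bnd j (f g) (M * w g).
    by apply: bnd_le (hM' g); rewrite ler_wpM2r ?weight_ge0 // ler_norm.
  have w0 : 0 <= rsum w by apply: rsum_ge0 => // g; exact: weight_ge0.
  exists (2 * (2 ^+ j * M) * rsum w).
    by rewrite mulr_ge0 // mulr_ge0 // mulr_ge0 ?exprn_ge0 /M.
  move=> u N Vu hN; rewrite addn0.
  rewrite (_ : _ * N = 2 * (2 ^+ j * (M * N)) * rsum w); last by ring.
  apply: (bnd_csum sw (smooth_family_op sf Vu)) => g.
  apply: (bnd_shift (- ang g) (CinfM (sf.1 g) Vu)).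
  have := bndM (sf.1 g) Vu (hM g) hN; apply: bnd_le.
  by rewrite le_eqVlt; apply/orP; left; apply/eqP; ring.
Qed.

(** The shear [(k, h) -> (k - h, h)] is a bijection of Z^n x Z^n, so both iterated sums equal one
    double sum. *)
Lemma csum_convolution (a : Zn * Zn -> C) : csummable a ->
  csum (fun k => csum (fun h => a (k - h, h))) = csum (fun g => csum (fun h => a (g, h))).
Proof.
move=> sa; pose e (p : Zn * Zn) := (p.1 - p.2, p.2).
have be : bijective e.
  by exists (fun p => (p.1 + p.2, p.2)) => -[p q]; rewrite /e /= ?subrK ?addrK.
rewrite (csum_fubini sa) -(reindex_csum a be).
have sae : csummable (fun p => a (e p)) := reindex_abs_summable be sa.
exact: (csum_fubini sae).
Qed.

Lemma csum_swap (a : Zn * Zn -> C) : csummable a ->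
  csum (fun h => csum (fun g => a (g, h))) = csum (fun g => csum (fun h => a (g, h))).
Proof.
move=> sa; pose e (p : Zn * Zn) := (p.2, p.1).
have be : bijective e by exists e => -[].
rewrite (csum_fubini sa) -(reindex_csum a be).
have sae : csummable (fun p => a (e p)) := reindex_abs_summable be sa.
exact: (csum_fubini sae).
Qed.

Lemma smooth_family_bound f : smooth_family w f ->
  exists2 M, 0 <= M & forall g x, norm1 (f g x) <= M * w g.
Proof.
move=> [_ /(_ 0%N)[M hM]]; exists `|M| => // g x.
apply: le_trans (bnd_val (hM g) x) _.
by rewrite ler_wpM2r ?weight_ge0 // ler_norm.
Qed.

Lemma csummable_pair (a : Zn * Zn -> C) (M : R) :
  (forall g h, norm1 (a (g, h)) <= M * (w g * w h)) -> csummable a.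
Proof.
move=> ha; have sw := abs_summable_weight R n.
by apply: (csummable_dom (abs_summable_prod sw sw)) => -[g h]; exact: ha.
Qed.

Lemma csumMr (I : choiceType) (F : I -> C) (c : C) : csummable F ->
  csum (fun i => F i * c) = csum F * c.
Proof. by move=> sF; rewrite mulrC -csumM //; apply: eq_csum => i; rewrite mulrC. Qed.

Lemma csummable_mul f1 f2 (y z : Zn -> R) : smooth_family w f1 -> smooth_family w f2 ->
  forall k, csummable (fun h => f1 (k - h) (y h) * f2 h (z h)).
Proof.
move=> s1 s2 k; have [M M0 hM] := smooth_family_bound s1.
have [N N0 hN] := smooth_family_bound s2.
apply: (csummable_dom (M := M * N) (abs_summable_weight R n)) => h.
apply: le_trans (norm1M _ _) _; rewrite -mulrA ler_pM ?norm1_ge0 //.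
apply: le_trans (hM _ _) _; by rewrite ler_piMr ?weight_le1.
Qed.

(** In the composition the term [(g, h)] takes [f1 g] at [x - ang g] and both [f2 h] and [u] at
    [x - ang (g + h)]. With [k = g + h] the first point is [(x - ang k) + ang h], which is exactly
    the twist in [crossed_mul]; domination by [w g * w h] permits the rearrangement. *)
Lemma crossed_op_mul f1 f2 u : smooth_family w f1 -> smooth_family w f2 -> V u ->
  crossed_op (crossed_mul alpha f1 f2) u = crossed_op f1 (crossed_op f2 u).
Proof.
move=> s1 s2 Vu; apply/funext => x; rewrite /crossed_op /crossed_mul.
pose a (p : Zn * Zn) : C := f1 p.1 (x - ang p.1) *
  (f2 p.2 (x - ang p.1 - ang p.2) * u (x - ang p.1 - ang p.2)).
have [M M0 hM] := smooth_family_bound s1; have [N N0 hN] := smooth_family_bound s2.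
have [B hB] := Cinf_bounded Vu.
have B0 : 0 <= B by apply: le_trans (hB 0); exact: norm1_ge0.
have sa : csummable a.
  apply: (@csummable_pair _ (M * (N * B))) => g h; rewrite /a /=.
  apply: le_trans (norm1M _ _) _.
  rewrite [leRHS](_ : _ = M * w g * (N * w h * B)); last by ring.
  rewrite ler_pM ?norm1_ge0 //; apply: le_trans (norm1M _ _) _.
  by rewrite ler_pM ?norm1_ge0.
have -> : csum (fun g => f1 g (x - ang g) *
    csum (fun h => f2 h (x - ang g - ang h) * u (x - ang g - ang h))) =
    csum (fun g => csum (fun h => a (g, h))).
  apply: eq_csum => g; rewrite -csumM //.
  exact: (smooth_family_csummable (abs_summable_weight R n) (x - ang g) (smooth_family_op s2 Vu)).
rewrite -(csum_convolution sa); apply: eq_csum => k.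
rewrite -csumMr; last exact: (csummable_mul _ (fun=> x - ang k)).
apply: eq_csum => h; rewrite /a /= angleB -mulrA.
have -> : x - (ang k - ang h) = x - ang k + ang h by rewrite opprB addrA addrAC.
by rewrite addrK.
Qed.

(** The index of [f1] is determined by [k] and the two summation variables, so its weight is just
    bounded by 1, and summability over the pairs comes from [f2] and [f3]. *)
Lemma crossed_mulA f1 f2 f3 : smooth_family w f1 -> smooth_family w f2 ->
  smooth_family w f3 ->
  crossed_mul alpha (crossed_mul alpha f1 f2) f3 =
  crossed_mul alpha f1 (crossed_mul alpha f2 f3).
Proof.
move=> s1 s2 s3; apply/funext => k; apply/funext => x; rewrite /crossed_mul.
pose a (p : Zn * Zn) : C := f1 (k - p.2 - p.1) (x + ang p.2 + ang p.1) *
  (f2 p.1 (x + ang p.2) * f3 p.2 x).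
have [M M0 hM] := smooth_family_bound s1; have [N N0 hN] := smooth_family_bound s2.
have [B B0 hB] := smooth_family_bound s3.
have sa : csummable a.
  apply: (@csummable_pair _ (M * (N * B))) => g h; rewrite /a /=.
  apply: le_trans (norm1M _ _) _.
  rewrite [leRHS](_ : _ = M * (N * w g * (B * w h))); last by ring.
  rewrite ler_pM ?norm1_ge0 //.
    by apply: le_trans (hM _ _) _; rewrite ler_piMr ?weight_le1.
  by apply: le_trans (norm1M _ _) _; rewrite ler_pM ?norm1_ge0.
transitivity (csum (fun h => csum (fun g => a (g, h)))).
  apply: eq_csum => h.
  rewrite -csumMr; last exact: (csummable_mul (fun g => x + ang h + ang g) (fun=> x + ang h)).
  by apply: eq_csum => g; rewrite -mulrA.
rewrite (csum_swap sa) -(csum_convolution sa); apply: eq_csum => h.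
rewrite -csumM; last exact: (csummable_mul (fun g => x + ang g) (fun=> x)).
apply: eq_csum => l; rewrite /a /= angleB.
have -> : x + ang l + (ang h - ang l) = x + ang h by ring.
by rewrite opprB addrA subrK.
Qed.

Lemma crossed_mulr1 f : crossed_mul alpha f (@crossed_one R n) = f.
Proof.
apply/funext => k; apply/funext => x; rewrite /crossed_mul /crossed_one.
rewrite -[RHS](@csum_delta R Zn 0); apply: eq_csum => h.
by case: eqP => [->|_]; rewrite ?mulr0 // mulr1 subr0 angle0 addr0.
Qed.

Lemma crossed_mul1r f : crossed_mul alpha (@crossed_one R n) f = f.
Proof.
apply/funext => k; apply/funext => x; rewrite /crossed_mul /crossed_one.
rewrite -[RHS](@csum_delta R Zn k); apply: eq_csum => h.
by rewrite subr_eq0 eq_sym; case: eqP => [->|_]; rewrite ?mul0r ?mul1r.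
Qed.

Lemma crossed_op1 u : crossed_op (@crossed_one R n) u = u.
Proof.
apply/funext => x; rewrite /crossed_op /crossed_one.
rewrite -[RHS](@csum_delta R Zn 0); apply: eq_csum => h.
by case: eqP => [->|_]; rewrite ?mul0r // mul1r angle0 subr0.
Qed.

(** [f1 = f1 (f f2) = (f1 f) f2 = f2]. This pins down [crossed_inv], which is defined as a mere
    choice of inverse. *)
Lemma crossed_inverse_uniq f f1 f2 : in_crossed f ->
  crossed_inverse alpha f f1 -> crossed_inverse alpha f f2 -> f1 = f2.
Proof.
move=> /in_crossed_smooth sf [/in_crossed_smooth s1 _ h1] [/in_crossed_smooth s2 h2 _].
by rewrite -[f1]crossed_mulr1 -h2 -crossed_mulA // h1 crossed_mul1r.
Qed.

(** The operator of the inverse family is a two-sided inverse, since products act as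
    compositions. *)
Lemma bijective_endo_crossed_op f f' : in_crossed f -> crossed_inverse alpha f f' ->
  bijective_endo V (crossed_op f).
Proof.
move=> /in_crossed_smooth sf [/in_crossed_smooth sf' h h'].
split=> [u v Vu Vv e|u Vu].
  by rewrite -[u]crossed_op1 -[v]crossed_op1 -h' (crossed_op_mul sf' sf Vu) e crossed_op_mul.
exists (crossed_op f' u); first exact: (bounded_op_crossed sf').1.1.
by rewrite -(crossed_op_mul sf sf' Vu) h crossed_op1.
Qed.

Lemma in_crossed_sign f (s : C) : s = 1 \/ s = -1 -> in_crossed f ->
  in_crossed (fun g x => s * f g x).
Proof.
case=> -> [Vf hf]; first by under eq_fun do under eq_fun do rewrite mul1r.
have E g i : iter i (@cderive R) (fun x => -1 * f g x) = (-1 : C) *: iter i (@cderive R) (f g).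
  elim: i => [|i IH]; first by [].
  by rewrite !iterS IH; exact: cderiveZ (Cinf_iter_cderive i (Vf g)).
split=> [g|k l].
  have h : V ((-1 : C) *: f g) := subspaceZ (-1) (Cinf_subspace R) (Vf g).
  exact: h.
have [M hM] := hf k l; exists M => g j x jk; rewrite E.
have -> : ((-1 : C) *: iter j (@cderive R) (f g)) x = - iter j (@cderive R) (f g) x.
  by rewrite -[LHS]/(-1 * iter j (@cderive R) (f g) x) mulN1r.
by rewrite normcN; exact: hM.
Qed.

Lemma crossed_invP f : crossed_invertible alpha f ->
  crossed_inverse alpha f (crossed_inv alpha f).
Proof. by move=> [f1 h1]; rewrite /crossed_inv; case: xgetP => [//|/(_ f1)]. Qed.

(** The inverse of [s f] is [s] times the inverse of [f], by uniqueness, and its factor [s] meets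
    the one in the differential of [s f]; then [s * s = 1]. *)
Lemma log_derive0_sign f (s : C) : s = 1 \/ s = -1 -> in_crossed f ->
  crossed_invertible alpha f ->
  crossed_invertible alpha (fun g x => s * f g x) ->
  log_derive0 alpha (fun g x => s * f g x) = log_derive0 alpha f.
Proof.
move=> s1 cf if_ isf.
have ss : s * s = 1 by case: s1 => ->; rewrite ?mulrNN mulr1.
have sinv f3 : crossed_inverse alpha (fun g x => s * f g x) f3 ->
    crossed_inverse alpha f (fun g x => s * f3 g x).
  move=> [c3 h h']; split; first exact: in_crossed_sign.
  - rewrite -h; apply/funext => k; apply/funext => x; apply: eq_csum => g.
    by rewrite mulrCA mulrA.
  - rewrite -h'; apply/funext => k; apply/funext => x; apply: eq_csum => g.
    by rewrite mulrCA mulrA.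
have E : crossed_inv alpha f = fun g x => s * crossed_inv alpha (fun g x => s * f g x) g x.
  exact: crossed_inverse_uniq cf (crossed_invP if_) (sinv _ (crossed_invP isf)).
rewrite /log_derive0 E; apply/funext => x; apply: eq_csum => g.
rewrite /crossed_d; have -> : cderive (fun x => s * f g x) = s *: cderive (f g).
  exact: cderiveZ (cf.1 g).
by rewrite -[(s *: _) x]/(s * cderive (f g) x) mulrCA mulrA.
Qed.

End CrossedProduct.

(** * Inverting d/dx modulo finite rank *)

Section Primitive.
Variable R : realType.
Local Notation mu := (@lebesgue_measure R).

(** The primitive is defined by cases on both sides of 0. Near a given [x] it equals [F - F 0],
    where [F] integrates from a base point [b] below both 0 and [x], so the fundamental theorem with
    fixed lower endpoint applies. *)
Lemma continuous_primitive (a : R -> R) : continuous a ->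
  exists P : R -> R, forall x : R, is_derive x 1 P (a x).
Proof.
move=> ca; have ia (b c : R) : mu.-integrable `[b, c] (EFin \o a).
  apply: continuous_compact_integrable; first exact: segment_compact.
  exact: continuous_subspaceT.
pose P (x : R) : R := if 0 <= x then \int[mu]_(t in `]0, x]) a t
                      else - \int[mu]_(t in `]x, 0]) a t.
exists P => x; pose b := - (`|x| + 1) : R.
have bx : b < x by rewrite /b; case: (ger0P x); lra.
have b0 : b < 0 by rewrite /b ltrNl oppr0 ltr_wpDl.
pose F (y : R) : R := \int[mu]_(t in `[b, y]) a t.
have PF (y : R) : b < y -> P y = F y - F 0.
  move=> yb; rewrite /P /F; case: (leP 0 y) => y0.
    by rewrite Rintegral_itvB // bnd_simp ltW.
  by rewrite -opprB Rintegral_itvB // bnd_simp ltW.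
have [dF F'] : derivable F x 1 /\ derive1 F x = a x.
  have h1 : x < x + 1 by rewrite ltrDl.
  exact: (@continuous_FTC1_closed R a b x (x + 1) h1 (ia b (x + 1)) bx (ca x)).
have dP : is_derive x 1 (fun y => F y - F 0) (a x).
  have h : is_derive x 1 F (a x) by rewrite -F' derive1E; exact: DeriveDef dF erefl.
  by have := is_deriveB h (is_derive_cst (F 0) x 1); rewrite subr0.
apply: (@near_eq_is_derive _ _ _ (fun y => F y - F 0) P x 1 (a x)) => //.
have := @Nlt_nbhsl R x (- b); rewrite ltrN2 => /(_ bx).
by apply: filterS => y; rewrite ltrN2 => /PF ->.
Qed.

End Primitive.

Section FirstOrder.
Variable R : realType.
Local Notation C := (R[i]^o).
Local Notation V := (@Cinf_circle R).
Implicit Types (u v w : R -> C) (x : R).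

Lemma Cinf_primitive v : V v -> exists P : R -> C, forall x, is_cderive P x (v x).
Proof.
move=> Vv.
have [|P hP] := @continuous_primitive R (fun x => Re (v x)).
  by move=> x; exact: is_derive_continuous (Cinf_is_cderive x Vv).1.
have [|Q hQ] := @continuous_primitive R (fun x => Im (v x)).
  by move=> x; exact: is_derive_continuous (Cinf_is_cderive x Vv).2.
by exists (fun x => P x +i* Q x) => x; split; [exact: hP|exact: hQ].
Qed.

(** The class stable under [cderive] is [V] with [w] added. *)
Lemma Cinf_of_cderive w v : (forall x, w (x + 2 * pi) = w x) -> V v ->
  (forall x, is_cderive w x (v x)) -> V w.
Proof.
move=> wp Vv hw; have E : cderive w = v by apply/funext => x; exact: is_cderive_val.
apply: (@Cinf_coind R (fun f => V f \/ f = w)); last by right.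
move=> f [Vf|->].
  split=> [x|x|]; [exact: Cinf_periodic|exact: Cinf_cderivable|].
  by left; exact: Cinf_cderive.
by split=> [//|x|]; [exact: is_cderive_cderivable (hw x)|left; rewrite E].
Qed.

Definition ev0 u : R -> C := fun=> u 0.

(** [cderive] kills the constants and reaches only functions of mean zero; the rank one term [ev0]
    repairs both defects. *)
Definition cderive0 u : R -> C := cderive u + ev0 u.

Lemma linear_endo_ev0 : linear_endo V ev0.
Proof. by split=> [u _|a u v _ _]; [exact: Cinf_cst|]. Qed.

Lemma finite_rank_ev0 : finite_rank V ev0.
Proof.
apply: (@eq_finite_rank _ _ _ (fun u => (u 0 : R[i]) *: (fun=> 1 : C))).
  by move=> u _; apply/funext => x; rewrite -[LHS]/(u 0 * 1) mulr1.
apply: finite_rank1; first by [].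
exact: Cinf_cst.
Qed.

Lemma linear_endo_cderive0 : linear_endo V cderive0.
Proof.
exact: linear_endo_add (Cinf_subspace R) _ _ (linear_endo_cderive R) linear_endo_ev0.
Qed.

Lemma is_cderive_linear (c : C) x : is_cderive (fun y => y%:C * c) x c.
Proof.
split.
  under eq_fun do rewrite cReM /= mul0r subr0.
  apply: (is_derive_eq (is_deriveM (is_derive_id x 1) (is_derive_cst (Re c) x 1))).
  by rewrite scaler0 add0r [LHS]mulr1.
under eq_fun do rewrite cImM /= mul0r addr0.
apply: (is_derive_eq (is_deriveM (is_derive_id x 1) (is_derive_cst (Im c) x 1))).
by rewrite scaler0 add0r [LHS]mulr1.
Qed.

Lemma is_cderive_cderive0 w x : V w ->
  is_cderive (fun y => w y + y%:C * w 0) x (cderive0 w x).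
Proof. by move=> Vw; exact: is_cderiveD (Cinf_is_cderive x Vw) (is_cderive_linear _ _). Qed.

(** [w y + y * w 0] is a primitive of [cderive0 w], and its periodic part drops out of the increment
    over a period: [2 pi norm1 (w 0) <= 2 M * 2 pi]. *)
Lemma cderive0_ev0_bound w M : V w -> (forall x, norm1 (cderive0 w x) <= M) ->
  norm1 (w 0) <= 2 * M.
Proof.
move=> Vw hM; have p0 : 0 < 2 * pi :> R by rewrite mulr_gt0 // pi_gt0.
have := cmean_value_le (fun x => is_cderive_cderive0 x Vw) (fun x _ => hM x) (a := 0) (b := 2 * pi).
have -> : w (2 * pi) = w 0 by rewrite -(Cinf_periodic 0 Vw) add0r.
rewrite mul0r addr0 addrAC subrr add0r.
by rewrite norm1Mr subr0 mulrC ler_pM2r // gtr0_norm.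
Qed.

(** Subtracting [w 0], of norm at most [2 M], bounds the derivative of [w] by [3 M]; moving from 0
    by at most [2 pi] then bounds [w] by [2 M + 2 * 3 M * 2 pi]. *)
Lemma cderive0_bound w M j : V w -> bnd j (cderive0 w) M -> bnd j.+1 w ((2 + 12 * pi) * M).
Proof.
move=> Vw hM; have p0 : 0 < pi :> R := pi_gt0 R.
have p2 : 2 <= pi :> R := pi_ge2 R.
have M0 := bnd_ge0 hM.
have h0 := cderive0_ev0_bound Vw (bnd_val hM).
have E : cderive w = cderive0 w + (fun=> - w 0).
  by apply/funext => x; rewrite /cderive0 -[RHS]/(cderive w x + w 0 - w 0) addrK.
have hd : bnd j (cderive w) (3 * M).
  have Vc : V (fun=> - w 0) by exact: Cinf_cst.
  have := bndD (linear_endo_in linear_endo_cderive0 Vw) Vc hM (bnd_cst _).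
  rewrite -E; apply: bnd_le; rewrite norm1N; lra.
apply: bndS; last by apply: bnd_le hd; rewrite ler_wpM2r //; lra.
move=> x; have [k /andP[k1 k2]] := reduce_mod_2pi 0 x.
rewrite -(periodicZ k (fun x => Cinf_periodic x Vw)); set y := x + _ in k1 k2 *.
have := cmean_value_le (fun x => Cinf_is_cderive x Vw) (fun x _ => bnd_val hd x) (a := 0) (b := y).
have := norm1D (w y - w 0) (w 0); rewrite subrK subr0 (ger0_norm k1).
have : 2 * (3 * M) * y <= 2 * (3 * M) * (2 * pi) by rewrite ler_wpM2l ?mulr_ge0 //; lra.
lra.
Qed.

Lemma bijective_endo_cderive0 : bijective_endo V cderive0.
Proof.
have p0 : 2 * pi != 0 :> R by rewrite gt_eqF // mulr_gt0 // pi_gt0.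
split=> [u v Vu Vv e|v Vv].
  apply/eqP; rewrite -subr_eq0; apply/eqP.
  have Vz : V (u - v) by exact: subspaceB (Cinf_subspace R) Vu Vv.
  have z0 : cderive0 (u - v) = 0.
    by rewrite (linear_endoB (Cinf_subspace R) linear_endo_cderive0 Vu Vv) e subrr.
  (* Injectivity is the estimate [cderive0_bound] with [M = 0]. *)
  have h : bnd 0 (cderive0 (u - v)) 0 by apply: bnd0 => x; rewrite z0 norm10.
  apply/funext => x; apply: norm1_eq0; apply/eqP; rewrite eq_le norm1_ge0 andbT.
  by have := bnd_val (cderive0_bound Vz h) x; rewrite mulr0.
have [P hP] := Cinf_primitive Vv.
(* [c] is the mean of [v], so [v - c] has a periodic primitive; normalising it by [w 0 = c] gives
   [w' + w 0 = v]. *)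
pose c : C := (2 * pi)^-1%:C * (P (2 * pi) - P 0).
pose w x : C := P x - P 0 + (x%:C * - c + c).
have hw x : is_cderive w x (v x - c).
  have := is_cderiveD (is_cderiveD (hP x) (is_cderive_cst (- P 0) x))
    (is_cderiveD (is_cderive_linear (- c) x) (is_cderive_cst c x)).
  by rewrite !addr0.
have wp x : w (x + 2 * pi) = w x.
  have hq y : is_cderive (fun y => P (y + 2 * pi) - P y) y 0.
    have hN : is_cderive (fun y => -1 * P y) y (0 * P y + -1 * v y).
      exact: is_cderiveM (is_cderive_cst (-1 : C) y) (hP y).
    have := is_cderiveD (is_cderive_shift (hP (y + 2 * pi))) hN.
    rewrite Cinf_periodic // mul0r add0r mulN1r subrr.
    by under eq_fun do rewrite mulN1r.
  have := cderive0_cst hq x 0; rewrite add0r => hx.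
  have cE : (2 * pi)%:C * c = P (x + 2 * pi) - P x.
    by rewrite /c mulrA -rmorphM /= divff // mul1r hx.
  have {}cE : P (x + 2 * pi) = P x + (2 * pi)%:C * c by rewrite cE addrCA subrr addr0.
  rewrite /w cE rmorphD; ring.
have Vw : V w.
  apply: (Cinf_of_cderive wp _ hw).
  exact: subspaceB (Cinf_subspace R) Vv (Cinf_cst c).
exists w => //; apply/funext => x.
rewrite /cderive0 -[LHS]/(cderive w x + w 0) (is_cderive_val (hw x)) /w.
by rewrite subrr mul0r !add0r subrK.
Qed.

(** The last clause bounds the derivative of [J u] by the sup norm of [u] with an explicit constant,
    in the form in which the interpolation estimate takes it. *)
Lemma cderive0_inverse : exists J, [/\ bounded_op 1 J, {in V, cancel cderive0 J},
  {in V, cancel J cderive0} &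
  forall u M, V u -> (forall x, norm1 (u x) <= M) -> forall x, norm1 (cderive (J u) x) <= 3 * M].
Proof.
have [J [lJ h1 h2]] := bijective_endo_inverse (Cinf_subspace R) linear_endo_cderive0 bijective_endo_cderive0.
exists J; split=> //.
  split=> // j; exists (2 + 12 * pi); first by have := pi_gt0 R; lra.
  move=> u M Vu hu; rewrite addn1; apply: cderive0_bound; first exact: lJ.1.
  by rewrite h2 //; exact: mem_set.
move=> u M Vu hu x.
have E : cderive0 (J u) = u by apply: h2; exact: mem_set.
have h0 : norm1 (J u 0) <= 2 * M.
  by apply: cderive0_ev0_bound; [exact: lJ.1|rewrite E].
have -> : cderive (J u) x = u x - J u 0.
  by rewrite -[in u x]E -[cderive0 _ x]/(cderive (J u) x + J u 0) addrK.
apply: le_trans (norm1D _ _) _; rewrite norm1N; have := hu x; lra.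
Qed.

End FirstOrder.

(** * Fejer interpolation *)

Section Fejer.
Variable R : realType.
Local Notation C := (R[i]^o).
Local Notation V := (@Cinf_circle R).
Implicit Types (u v : R -> C) (x y t : R) (z : R[i]).

Definition expi t : R[i] := cos t +i* sin t.

Lemma expi0 : expi 0 = 1.
Proof. by rewrite /expi cos0 sin0. Qed.

Lemma expiD s t : expi (s + t) = expi s * expi t.
Proof. by rewrite /expi cosD sinD; simpc; rewrite [_ + _ * cos t]addrC. Qed.

Lemma expi_natl (k : nat) t : expi (k%:R * t) = expi t ^+ k.
Proof.
elim: k => [|k IH]; first by rewrite mul0r expi0.
by rewrite -natr1 mulrDl mul1r expiD IH exprSr.
Qed.

Lemma conjc_expi t : conjc (expi t) = expi (- t).
Proof. by rewrite /expi cosN sinN. Qed.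

Lemma expi_mul_conj t : expi t * conjc (expi t) = 1.
Proof. by rewrite conjc_expi -expiD subrr expi0. Qed.

(** [1 - cos t = 2 sin^2 (t / 2)], and the sine is positive strictly between 0 and [pi]. *)
Lemma cos_lt1 t : 0 < t < 2 * pi -> cos t < 1.
Proof.
move=> /andP[t0 t1]; rewrite (_ : t = (t / 2) *+ 2); last by rewrite -mulr_natr divfK.
have s0 : 0 < sin (t / 2) by apply: sin_gt0_pi; apply/andP; split; lra.
have := cos2sin2 (t / 2); rewrite cos_mulr2n => ->.
have : 0 < sin (t / 2) ^+ 2 by rewrite exprn_gt0.
rewrite mulr2n; lra.
Qed.

Definition sqn z : R := Re z ^+ 2 + Im z ^+ 2.

Lemma sqnE z : z * conjc z = (sqn z)%:C.
Proof. by case: z => a b; apply: complex_ext; rewrite /sqn /=; ring. Qed.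

Lemma sqn_ge0 z : 0 <= sqn z. Proof. by rewrite addr_ge0 ?sqr_ge0. Qed.

Lemma sqnM z1 z2 : sqn (z1 * z2) = sqn z1 * sqn z2.
Proof. by case: z1 z2 => a b [c d]; rewrite /sqn /=; ring. Qed.

Lemma sqn_1expi t : sqn (expi t - 1) = 2 * (1 - cos t).
Proof.
rewrite /sqn /= oppr0 addr0; have := cos2Dsin2 t; set c := cos t; set s := sin t.
by move=> h; rewrite -[s ^+ 2](addKr (c ^+ 2)) h; ring.
Qed.

Lemma conj_power_prod z (k l : nat) :
  conjc (z ^+ k * conjc z ^+ l) = z ^+ l * conjc z ^+ k.
Proof. by rewrite rmorphM !rmorphXn /= conjcK mulrC. Qed.

Lemma sqn_sum z (N : nat) :
  (sqn (\sum_(k < N) z ^+ k))%:C = \sum_(k < N) \sum_(l < N) z ^+ k * conjc z ^+ l.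
Proof.
rewrite -sqnE rmorph_sum /= big_distrlr /=; apply: eq_bigr => k _.
by apply: eq_bigr => l _; rewrite rmorphXn.
Qed.

Section Kernel.
Variable N : nat.
Hypothesis N_gt0 : (0 < N)%N.

Let root : R[i] := expi (- (2 * pi / N%:R)).

Let N_neq0 : N%:R != 0 :> R. Proof. by rewrite pnatr_eq0 -lt0n. Qed.

Lemma expi_2pi : expi (2 * pi) = 1.
Proof. by rewrite /expi mulr_natl cos2pi sin2pi. Qed.

Lemma root_expN : root ^+ N = 1.
Proof.
rewrite /root -conjc_expi -rmorphXn /= -expi_natl mulrCA divff // mulr1.
by rewrite expi_2pi conjc1.
Qed.

Lemma root_exp_neq1 k : (0 < k < N)%N -> root ^+ k != 1.
Proof.
move=> /andP[k0 kN]; rewrite /root -conjc_expi -rmorphXn /= -expi_natl.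
apply/negP => /eqP/(congr1 (@complex.Re R)) /= h.
have Np : 0 < N%:R :> R by rewrite ltr0n.
have p0 : 0 < 2 * pi :> R by rewrite mulr_gt0 // pi_gt0.
have : cos (k%:R * (2 * pi / N%:R)) < 1 :> R.
  apply: cos_lt1; rewrite mulr_gt0 ?ltr0n ?divr_gt0 //=.
  by rewrite mulrCA -[ltRHS]mulr1 ltr_pM2l // ltr_pdivrMr // mul1r ltr_nat.
by rewrite h ltxx.
Qed.

(** A geometric sum with ratio [root^(k - l)], the conjugate of [root] serving as its inverse. For
    [k != l] the ratio is an N-th root of unity other than 1, because [k] and [l] differ by less
    than [N]. *)
Lemma sum_root_powers k l : (k < N)%N -> (l < N)%N ->
  \sum_(j < N) (root ^+ k * (conjc root) ^+ l) ^+ j = if k == l then N%:R else 0.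
Proof.
move=> kN lN; set q := _ * _.
have rr : root * conjc root = 1 by rewrite /root expi_mul_conj.
have qN : q ^+ N = 1.
  have cN : conjc root ^+ N = 1 by rewrite -rmorphXn /= root_expN conjc1.
  by rewrite /q exprMn (exprAC root) (exprAC (conjc root)) root_expN cN !expr1n mulr1.
case: eqVneq => [kl|kl].
  have -> : q = 1 by rewrite /q kl -exprMn rr expr1n.
  by under eq_bigr do rewrite expr1n; rewrite sumr_const card_ord.
have q1 : q != 1.
  have main k' l' : (l' < k' < N)%N -> root ^+ k' * conjc root ^+ l' != 1.
    move=> /andP[lk kN']; rewrite -(subnK (ltnW lk)) exprD -mulrA -exprMn rr expr1n mulr1.
    by apply: root_exp_neq1; rewrite subn_gt0 lk (leq_ltn_trans (leq_subr _ _)).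
  have [lk|lk|/eqP] := ltngtP l k; last by rewrite eq_sym (negPf kl).
    by apply: main; rewrite lk.
  (* The case [k < l] is the complex conjugate of the case [l < k]. *)
  apply: contra_neq (main l k _); last by rewrite lk.
  by move=> /(congr1 (@conjc R)); rewrite conj_power_prod conjc1.
have q10 : q - 1 != 0 by rewrite subr_eq0.
by apply: (mulfI q10); rewrite -subrX1 qN subrr mulr0.
Qed.

Definition node (j : 'I_N) : R := 2 * pi / N%:R * j%:R.

Definition dirichlet (t : R) : R[i] := \sum_(k < N) expi t ^+ k.

(** The classical Fejer kernel [|sum_(k < N) e^(ikt)|^2 / N], centred at the node, with a further
    [1 / N] as the weight of a Riemann sum over [N] nodes. *)
Definition fejer (j : 'I_N) (x : R) : R := sqn (dirichlet (x - node j)) / N%:R ^+ 2.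

Lemma fejer_ge0 j x : 0 <= fejer j x.
Proof. by rewrite divr_ge0 ?sqn_ge0 ?exprn_ge0. Qed.

Lemma expi_node x j : expi (x - node j) = expi x * root ^+ j.
Proof. by rewrite expiD /root -expi_natl /node mulrN [j%:R * _]mulrC. Qed.

(** Expanding the square gives a double sum over [k] and [l]; summation over the nodes annihilates
    the terms with [k != l] and leaves [N] for each of the [N] diagonal ones. *)
Lemma fejer_sum x : \sum_j fejer j x = 1.
Proof.
apply: (@complexI R); rewrite -mulr_suml rmorphM rmorph_sum /=.
have E (j : 'I_N) : (sqn (dirichlet (x - node j)))%:C =
    \sum_(k < N) \sum_(l < N) expi x ^+ k * conjc (expi x) ^+ l *
      (root ^+ k * conjc root ^+ l) ^+ j.
  rewrite sqn_sum; apply: eq_bigr => k _; apply: eq_bigr => l _.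
  rewrite expi_node; move: (expi x) root => e r.
  rewrite rmorphM rmorphXn /= !exprMn mulrACA; congr (_ * (_ * _)); exact: exprAC.
rewrite (eq_bigr _ (fun j _ => E j)) exchange_big /=.
have E2 (k : 'I_N) : \sum_(j < N) \sum_(l < N) expi x ^+ k * conjc (expi x) ^+ l *
      (root ^+ k * conjc root ^+ l) ^+ j = N%:R.
  rewrite exchange_big /= (bigD1 k) //= -mulr_sumr sum_root_powers // eqxx.
  rewrite -exprMn expi_mul_conj expr1n mul1r big1 ?addr0 // => l lk.
  rewrite -mulr_sumr sum_root_powers // ifN ?mulr0 //.
  by rewrite eq_sym.
rewrite (eq_bigr _ (fun k _ => E2 k)) sumr_const card_ord.
have -> : N%:R *+ N = (N%:R ^+ 2)%:C :> R[i].
  by rewrite rmorphXn rmorph_nat expr2 mulr_natr.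
by rewrite -rmorphM divff // expf_neq0.
Qed.

(** Summing the geometric series gives [|e^(it) - 1|^2 |dirichlet t|^2 = |e^(iNt) - 1|^2], that is
    [(1 - cos t) |dirichlet t|^2 = 1 - cos (N t) <= 2]. *)
Lemma fejer_concentrated j x : fejer j x * (1 - cos (x - node j)) <= 2 / N%:R ^+ 2.
Proof.
rewrite mulrAC ler_wpM2r ?invr_ge0 ?exprn_ge0 //.
set t := x - node j.
have : sqn (expi t - 1) * sqn (dirichlet t) = 2 * (1 - cos (N%:R * t)).
  by rewrite -sqnM /dirichlet -subrX1 -expi_natl sqn_1expi.
rewrite sqn_1expi => h.
have {}h : (1 - cos t) * sqn (dirichlet t) = 1 - cos (N%:R * t).
  by apply: (@mulfI _ (2 : R)); rewrite // mulrA.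
rewrite mulrC h; have := cos_geN1 (N%:R * t); lra.
Qed.

End Kernel.

(** A class stable under [cderive]: the derivative of [trig a b] is [trig b (- a)]. *)
Definition trig (a b : C) x : C := (cos x)%:C * a + (sin x)%:C * b.

Lemma is_cderive_real (f : R -> R) (c : C) x d : is_derive x 1 f d ->
  is_cderive (fun y => (f y)%:C * c) x (d%:C * c).
Proof.
move=> df; split.
  under eq_fun do rewrite cReM /= mul0r subr0.
  apply: (is_derive_eq (is_deriveM df (is_derive_cst (Re c) x 1))).
  by rewrite scaler0 add0r cReM /= mul0r subr0 mulrC.
under eq_fun do rewrite cImM /= mul0r addr0.
apply: (is_derive_eq (is_deriveM df (is_derive_cst (Im c) x 1))).
by rewrite scaler0 add0r cImM /= mul0r addr0 mulrC.
Qed.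

Lemma Cinf_trig a b : V (trig a b).
Proof.
apply: (@Cinf_coind R (fun f => exists a b, f = trig a b)); last by exists a, b.
move=> _ [{}a [{}b ->]].
have h x : is_cderive (trig a b) x (trig b (- a) x).
  have := is_cderiveD (is_cderive_real a (is_derive_cos x)) (is_cderive_real b (is_derive_sin x)).
  by rewrite /trig addrC rmorphN mulrN mulNr.
split=> [x|x|].
- by rewrite /trig !(mulr_natl pi) cosD2pi sinD2pi.
- exact: is_cderive_cderivable (h x).
- by exists b, (- a); apply/funext => x; exact: is_cderive_val (h x).
Qed.

Lemma Cinf_sum (I : Type) (r : seq I) (P : pred I) (F : I -> R -> C) :
  (forall i, P i -> V (F i)) -> V (fun x => \sum_(i <- r | P i) F i x).
Proof.
move=> VF; rewrite (_ : (fun x => _) = \sum_(i <- r | P i) F i).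
  exact: subspace_sum (Cinf_subspace R) VF.
by apply/funext => x; rewrite fct_sumE.
Qed.

Lemma CinfX u k : V u -> V (fun x => u x ^+ k).
Proof.
move=> Vu; elim: k => [|k IH]; first exact: Cinf_cst.
by under eq_fun do rewrite exprS; exact: CinfM Vu IH.
Qed.

Lemma Cinf_fejer N (j : 'I_N) : V (fun x => (fejer j x)%:C).
Proof.
have Vd : V (fun x => dirichlet N (x - node j)).
  apply: (@Cinf_shift R (dirichlet N) (- node j)).
  apply: Cinf_sum => k _; apply: CinfX.
  rewrite (_ : expi = trig 1 'i); first exact: Cinf_trig.
  by apply/funext => x; apply: complex_ext; rewrite /= /trig; ring.
have Vc : V (fun x => conjc (dirichlet N (x - node j))).
  apply: (@Cinf_shift R (fun x => conjc (dirichlet N x)) (- node j)).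
  under eq_fun do rewrite /dirichlet rmorph_sum /=.
  apply: Cinf_sum => k _.
  under eq_fun do rewrite rmorphXn /=.
  apply: CinfX; rewrite (_ : (fun x => _) = trig 1 (- 'i)); first exact: Cinf_trig.
  by apply/funext => x; apply: complex_ext; rewrite /= /trig; ring.
under eq_fun do rewrite /fejer rmorphM /= -sqnE.
exact: CinfM (CinfM Vd Vc) (Cinf_cst _).
Qed.

(** Let [t] be [x - y] reduced to the period around 0. For [|t| <= d] the first term suffices;
    otherwise [1 - cos t >= 1 - cos d], and the second is at least [pi >= |t|]. The distance is
    measured by [1 - cos] because that is what [fejer_concentrated] controls. *)
Lemma circle_lipschitz u L (d : R) : V u -> (forall x, norm1 (cderive u x) <= L) ->
  0 < d < pi -> forall x y,
  norm1 (u x - u y) <= 2 * L * (d + pi / (1 - cos d) * (1 - cos (x - y))).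
Proof.
move=> Vu hL /andP[d0 dpi] x y.
have L0 : 0 <= L by apply: le_trans (hL 0); exact: norm1_ge0.
have p0 : 0 < pi :> R := pi_gt0 R.
have cd : 0 < 1 - cos d.
  by rewrite subr_gt0; apply: cos_lt1; rewrite d0 /=; lra.
have [k /andP[k1 k2]] := reduce_mod_2pi (- pi) (x - y).
set t := x - y + _ in k1 k2.
have cosE : cos (x - y) = cos t.
  by rewrite /t (periodicZ k) // => z; rewrite mulr_natl cosD2pi.
have uE : u x = u (y + t).
  rewrite /t addrA [y + _]addrC subrK.
  by rewrite (periodicZ k (fun x => Cinf_periodic x Vu)).
have := cmean_value_le (fun x => Cinf_is_cderive x Vu) (fun x _ => hL x) (a := y) (b := y + t).
rewrite -uE [y + t]addrC addrK => h; apply: le_trans h _.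
rewrite ler_wpM2l ?mulr_ge0 // cosE.
have q0 : 0 <= pi / (1 - cos d) * (1 - cos t).
  by rewrite mulr_ge0 ?subr_ge0 ?cos_le1 // divr_ge0 ?ltW.
have [td|td] := leP `|t| d; first lra.
have tp : `|t| <= pi by rewrite ler_norml; apply/andP; split; lra.
suff : pi <= pi / (1 - cos d) * (1 - cos t) by lra.
rewrite mulrAC ler_pdivlMr // ler_pM2l // lerD2l lerN2 -[cos t]cos_norm ltW //.
by rewrite ltr_cos // in_itv /= ?tp ?normr_ge0 // ltW // ltW.
Qed.

(** As the kernels sum to 1, [u - F u] is an average of the differences [u x - u (node j)]. The near
    part is at most [2 L d]; the far part is at most [2 L K * (2 / N^2)] for each of the [N]
    nodes. *)
Lemma smooth_interpolation (e : R) : 0 < e -> exists F : (R -> C) -> R -> C,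
  [/\ bounded_op 0 F, finite_rank V F &
    forall u L, V u -> (forall x, norm1 (cderive u x) <= L) ->
      forall x, norm1 (u x - F u x) <= e * L].
Proof.
move=> e0.
have p0 : 0 < pi :> R := pi_gt0 R.
have p2 : 2 <= pi :> R := pi_ge2 R.
(* [e / 4] keeps the near part within half of the error; the minimum with 1 keeps [d] below [pi]. *)
pose d : R := Num.min 1 (e / 4).
have d0 : 0 < d by rewrite lt_min ltr01 divr_gt0.
have d1 : d < pi by rewrite (@le_lt_trans _ _ 1) ?ge_min ?lexx //; lra.
have de : d <= e / 4 by rewrite ge_min lexx orbT.
have cd : 0 < 1 - cos d.
  by rewrite subr_gt0; apply: cos_lt1; rewrite d0 /=; lra.
pose K : R := pi / (1 - cos d).
have K0 : 0 < K by rewrite divr_gt0.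
(* Chosen so that the far part [4 L K / N] is at most [e L / 2]. *)
pose N := (Num.truncn (8 * K / e)).+1.
have hN : 8 * K / e < N%:R by rewrite truncnS_gt.
have N0 : (0 < N)%N by [].
have Np : 0 < N%:R :> R by rewrite ltr0n.
pose F (u : R -> C) := \sum_(j < N) (u (node j) : R[i]) *: (fun x => (fejer j x)%:C : C).
exists F; split.
- apply: bounded_op_sum => j _; split.
    split=> [u Vu|a u v Vu Vv]; first exact: subspaceZ _ (Cinf_subspace R) (Cinf_fejer j).
    by rewrite scalerA -scalerDl.
  move=> k; have [M hM] := Cinf_bnd k (Cinf_fejer j).
  exists M => [|u B Vu hB]; first exact: bnd_ge0 hM.
  rewrite addn0; apply: bnd_le (bndZ _ (Cinf_fejer j) hM).
  by rewrite mulrC ler_wpM2l ?(bnd_ge0 hM) // (bnd_val hB).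
- apply: (finite_rank_sum (Cinf_subspace R)) => j _.
  by apply: finite_rank1 => //; exact: Cinf_fejer.
- move=> u L Vu hL x.
  have L0 : 0 <= L by apply: le_trans (hL 0); exact: norm1_ge0.
  have -> : u x - F u x = \sum_(j < N) (fejer j x)%:C * (u x - u (node j)).
    rewrite /F fct_sumE -[u x in LHS]mul1r -[1 in LHS](rmorph1 (real_complex R)).
    rewrite -(fejer_sum N0 x) rmorph_sum mulr_suml -sumrB; apply: eq_bigr => j _.
    by rewrite mulrBr; congr (_ - _); exact: mulrC.
  apply: le_trans (norm1_sum _ _ _) _.
  apply: (@le_trans _ _ (\sum_(j < N) (2 * L * d * fejer j x + 2 * L * K * (2 / N%:R ^+ 2)))).
    apply: ler_sum => j _; rewrite norm1Mr (ger0_norm (fejer_ge0 j x)).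
    have f0 := fejer_ge0 j x.
    apply: (le_trans (ler_wpM2l f0 (circle_lipschitz Vu hL _ x (node j) (d := d)))).
      by rewrite d0.
    rewrite -/K [leLHS](_ : _ = 2 * L * d * fejer j x +
      2 * L * K * (fejer j x * (1 - cos (x - node j)))); last by ring.
    rewrite lerD2l ler_wpM2l ?(mulr_ge0 (mulr_ge0 _ L0) (ltW K0)) //.
    exact: fejer_concentrated.
  rewrite big_split /= -mulr_sumr fejer_sum // mulr1 sumr_const card_ord.
  rewrite -[X in _ + X]mulr_natr.
  have -> : 2 * L * K * (2 / N%:R ^+ 2) * N%:R = L * (4 * K / N%:R).
    by field; rewrite gt_eqF.
  have : 4 * K / N%:R <= e / 2.
    by rewrite ler_pdivrMr //; move: hN; rewrite ltr_pdivrMr // => hN; lra.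
  have h1 : L * (2 * d) <= L * (e / 2) by rewrite ler_wpM2l //; lra.
  move=> h2; have h3 : L * (4 * K / N%:R) <= L * (e / 2) by rewrite ler_wpM2l.
  lra.
Qed.

End Fejer.

(** * Neumann series *)

Section Neumann.
Variable R : realType.
Local Notation C := (R[i]^o).
Local Notation V := (@Cinf_circle R).
Local Notation w := (fun n : nat => (2^-1 : R) ^+ n).
Implicit Types (f u v : R -> C) (x : R).

Lemma esum_nat_recl (a : nat -> \bar R) : a 0%N = 0%E ->
  (\esum_(i in [set: nat]) a i = \esum_(i in [set: nat]) a i.+1)%E.
Proof.
move=> a0; rewrite -(reindex_esum [set: nat] [set n | (0 < n)%N] succn a).
  rewrite [RHS]esum_mkcond; apply: eq_esum => -[|n] _.
    by rewrite memNset.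
  by rewrite mem_set.
split=> //; first by move=> i j _ _ [].
by case=> // n _; exists n.
Qed.

Lemma csum_nat_recl (F : nat -> C) : csummable F -> csum F = F 0%N + csum (fun n => F n.+1).
Proof.
move=> sF; pose G n : C := if n == 0%N then 0 else F n.
have sG : csummable G.
  apply: abs_summable_le sF => -[|n]; rewrite !(ger0_norm (norm1_ge0 _)) // norm10.
  exact: norm1_ge0.
have sd : csummable (fun n => if n == 0%N then F 0%N else 0).
  by apply: (@abs_summable_finite _ _ _ [:: 0%N]) => n; rewrite inE => /negPf ->; exact: norm10.
rewrite (@eq_csum _ _ F (fun n => (if n == 0%N then F 0%N else 0) + G n)); last first.
  by case=> [|n]; rewrite /G /= ?addr0 ?add0r.
rewrite csumD // csum_delta; congr (_ + _).
have r (g : nat -> R) : g 0%N = 0 -> rsum g = rsum (fun n => g n.+1).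
  by move=> g0; rewrite /rsum; congr (fine _ - fine _);
    rewrite esum_nat_recl // /funrpos /funrneg g0 ?oppr0 maxxx.
by apply: complex_ext; rewrite /= r.
Qed.

(** If [a > 0], then [2^n <= B / a] for every [n], which contradicts [n < 2^n] for large [n]. *)
Lemma geometric_small (a B : R) : (forall n, a <= B * w n) -> a <= 0.
Proof.
move=> h; rewrite leNgt; apply/negP => a0.
have B0 : 0 <= B by have := h 0%N; rewrite expr0 mulr1; lra.
have := h (Num.truncn (B / a)).+1; set n := (Num.truncn _).+1.
have hn : B / a < n%:R by rewrite truncnS_gt.
have nn : n%:R < 2 ^+ n :> R by rewrite -natrX ltr_nat ltn_expl.
rewrite exprVn ler_pdivlMr ?exprn_gt0 // leNgt => /negP; apply.
rewrite ltr_pdivrMr // in hn; apply: lt_trans hn _.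
by rewrite mulrC ltr_pM2l.
Qed.

Variable K : (R -> C) -> R -> C.
Hypothesis K_bounded : bounded_op 1 K.
Hypothesis K_contraction : forall u M, V u -> (forall x, norm1 (u x) <= M) ->
  forall x, norm1 (K u x) <= M / 2.

Let NK u : R -> C := (-1 : C) *: K u.

Let NK_bounded : bounded_op 1 NK. Proof. exact: bounded_op_scale. Qed.

Let NKE u x : NK u x = - K u x. Proof. exact: mulN1r. Qed.

Lemma iter_NK_in n f : V f -> V (iter n NK f).
Proof. by move=> Vf; exact: (linear_endo_iter n NK_bounded.1).1. Qed.

Lemma iter_NK_sup n f M : V f -> (forall x, norm1 (f x) <= M) ->
  forall x, norm1 (iter n NK f x) <= M * w n.
Proof.
move=> Vf hf; elim: n => [|n IH] x; first by rewrite expr0 mulr1.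
rewrite iterS NKE norm1N exprSr mulrA; apply: K_contraction IH x.
exact: iter_NK_in.
Qed.

(** Induction on the order: since [K] gains a derivative, iterate [n + 1] at order [j + 1] is
    bounded by [c] times iterate [n] at order [j]. So the rate 1/2 of the sup norm persists at every
    order; the shift of [n] costs the factor 2, and [M0] covers the iterate 0. *)
Lemma smooth_family_neumann f : V f -> smooth_family w (fun n => iter n NK f).
Proof.
move=> Vf; split=> [n|]; first exact: iter_NK_in.
elim=> [|j [M hM]].
  have [M hM] := Cinf_bounded Vf; exists M => n; apply: bnd0 => x.
  exact: iter_NK_sup.
have [c c0 hc] := NK_bounded.2 j; have [M0 hM0] := Cinf_bnd j.+1 Vf.
exists (Num.max M0 (2 * c * M)) => -[|n].
  by rewrite expr0 mulr1; apply: bnd_le hM0; rewrite le_max lexx.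
have := hc _ _ (iter_NK_in n Vf) (hM n); rewrite addn1 iterS; apply: bnd_le.
apply: (@le_trans _ _ (2 * c * M * 2^-1 ^+ n.+1)).
  by rewrite le_eqVlt; apply/orP; left; apply/eqP; rewrite exprS; field.
by rewrite ler_wpM2r ?exprn_ge0 ?invr_ge0 // le_max lexx orbT.
Qed.

Definition neumann f x : C := csum (fun n => iter n NK f x).

Let sw : abs_summable w := abs_summable_geometric R.

Lemma neumann_in f : V f -> V (neumann f).
Proof. by move=> Vf; have h := Cinf_csum sw (smooth_family_neumann Vf); exact: h. Qed.

Lemma neumann_rec f : V f -> neumann f = f + neumann (NK f).
Proof.
move=> Vf; apply/funext => x; rewrite -[RHS]/(f x + neumann (NK f) x) /neumann.
rewrite csum_nat_recl; last first.
  by have h := smooth_family_csummable sw x (smooth_family_neumann Vf); exact: h.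
by congr (_ + _); apply: eq_csum => n; rewrite -iterSr.
Qed.

Lemma neumann_sup f M : V f -> (forall x, norm1 (f x) <= M) ->
  forall x, norm1 (neumann f x) <= 2 * M * rsum w.
Proof.
by move=> Vf hf x; apply: (csum_norm1_le sw) => n; exact: iter_NK_sup.
Qed.

(** [K] is never commuted with the infinite sum. By [neumann_rec] the defect [err f] equals
    [err (NK f)], hence the defect of every iterate, and these tend to 0 geometrically in the sup
    norm. *)
Lemma neumann_solves f : V f -> neumann f + K (neumann f) = f.
Proof.
move=> Vf; pose err f := neumann f + K (neumann f) - f.
have sV := Cinf_subspace R.
have err_step g : V g -> err g = err (NK g).
  move=> Vg; have VNg : V (NK g) := NK_bounded.1.1 _ Vg.
  rewrite /err neumann_rec // (linear_endoD K_bounded.1 Vg (neumann_in VNg)).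
  have -> : K g = - NK g by apply/funext => x; rewrite -[RHS]/(- NK g x) NKE opprK.
  by rewrite addrAC [g + _]addrC addrK [- NK g + _]addrC addrA.
have err_iter n : err f = err (iter n NK f).
  by elim: n => // n ->; rewrite iterS; apply: err_step; exact: iter_NK_in.
have [M hM] := Cinf_bounded Vf.
suff : err f = 0 by move=> /eqP; rewrite subr_eq0 => /eqP.
apply/funext => x; apply/norm1_eq0/eqP; rewrite eq_le norm1_ge0 andbT.
(* Up to the factor [w n], [neumann g] contributes [2 M rsum w], its image under [K] half of that,
   and [g] itself [M]. *)
apply: (@geometric_small _ (3 * M * rsum w + M)) => n.
rewrite (err_iter n); set g := iter n NK f.
have Vg : V g by exact: iter_NK_in.
have hg := iter_NK_sup n Vf hM; rewrite -/g in hg.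
have h1 := neumann_sup Vg hg; have h2 := K_contraction (neumann_in Vg) h1 x.
apply: le_trans (norm1D _ _) _; rewrite norm1N.
apply: (@le_trans _ _ (2 * (M * w n) * rsum w + 2 * (M * w n) * rsum w / 2 + M * w n)).
  by apply: lerD (hg x); apply: le_trans (norm1D _ _) (lerD (h1 x) h2).
by rewrite le_eqVlt; apply/orP; left; apply/eqP; field.
Qed.

Lemma bijective_endo_id_plus : bijective_endo V (fun u => u + K u).
Proof.
have sV := Cinf_subspace R.
split=> [u v Vu Vv e|f Vf]; last first.
  by exists (neumann f); [exact: neumann_in|exact: neumann_solves].
have Vz : V (u - v) by exact: subspaceB.
(* A fixed point of [NK] is bounded by [M * 2^-n] for every [n], hence is 0. *)
have zE : NK (u - v) = u - v.
  rewrite /NK (linear_endoB sV K_bounded.1 Vu Vv) scaleN1r opprB.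
  have {}e : u + K u = v + K v := e.
  by apply/eqP; rewrite subr_eq addrAC e addrAC subrr add0r.
have iE n : iter n NK (u - v) = u - v by elim: n => // n; rewrite iterS => ->.
have [M hM] := Cinf_bounded Vz.
apply/eqP; rewrite -subr_eq0; apply/eqP/funext => x.
apply/norm1_eq0/eqP; rewrite eq_le norm1_ge0 andbT.
apply: (@geometric_small _ M) => n; rewrite -(iE n).
exact: iter_NK_sup.
Qed.

End Neumann.

(** * The index *)

Section Index.
Variable R : realType.
Local Notation C := (R[i]^o).
Local Notation V := (@Cinf_circle R).
Implicit Types (u v : R -> C) (x : R).

Lemma bijective_endo_scale (c : C) A : c != 0 -> bijective_endo V A ->
  bijective_endo V (fun u => c *: A u).
Proof.
move=> c0 [iA sA]; split=> [u v Vu Vv /= e|v Vv].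
  by apply: iA => //; apply: (scalerI (c0 : (c : R[i]) != 0)).
have [u Vu Au] := sA _ (subspaceZ (c^-1 : R[i]) (Cinf_subspace R) Vv).
exists u; first exact: Vu.
by rewrite Au scalerA mulfV // scale1r.
Qed.

(** With d for [cderive] and E for [cderive0]: d^(k+1) - E^(k+1) = d (d^k - E^k) + (d - E) E^k,
    where d - E = - [ev0] has rank at most one. *)
Lemma finite_rank_iter_cderive k :
  finite_rank V (fun u => iter k (@cderive R) u - iter k (@cderive0 R) u).
Proof.
have sV := Cinf_subspace R.
have lE := linear_endo_cderive0 R.
elim: k => [|k IH].
  by apply: (eq_finite_rank _ (finite_rank0 sV)) => u _; rewrite subrr.
have h1 := finite_rank_compl sV (linear_endo_cderive R) IH.
have h2 : finite_rank V (fun u => (-1 : R[i]) *: ev0 u).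
  exact: (finite_rank_compl sV (linear_endo_scale sV (-1) (linear_endo_id V)) (finite_rank_ev0 R)).
have h3 := finite_rank_compr h2 (linear_endo_iter k lE).
apply: (eq_finite_rank _ (finite_rank_add h1 h3)) => u Vu /=.
have V1 : V (iter k (@cderive R) u) := Cinf_iter_cderive k Vu.
have V2 : V (iter k (@cderive0 R) u) := (linear_endo_iter k lE).1 _ Vu.
rewrite (linear_endoB sV (linear_endo_cderive R) V1 V2) scaleN1r /cderive0.
by rewrite opprD addrA.
Qed.

(* [D] agrees with [A_m (1 + B (Q J)) cderive0^m] modulo finite rank, where [J]
   inverts [cderive0], [Q = 1 - F], and [A_m B J] is the sum of the lower order
   terms of [D] composed with [cderive0^-m]. *)
Lemma leading_invertible_index (m : nat) (A : nat -> (R -> C) -> R -> C)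
    (A' : (R -> C) -> R -> C) :
  (forall l, (l <= m)%N -> bounded_op 0 (A l)) -> bounded_op 0 A' ->
  bijective_endo V (A m) -> (forall u, V u -> A m (A' u) = u) ->
  forall D : (R -> C) -> R -> C,
  (forall u, V u -> D u = \sum_(l < m.+1) A l (iter l (@cderive R) u)) ->
  fredholm V D /\ fredholm_index V D = 0.
Proof.
move=> hA hA' bAm AmK D DE.
have sV := Cinf_subspace R; have lE := linear_endo_cderive0 R.
have lA l : (l <= m)%N -> linear_endo V (A l) by move=> /hA[].
have [J [hJ EJ JE J3]] := cderive0_inverse R.
have hJ0 := bounded_op_weaken hJ.
(* After division by [cderive0^m] each lower order term carries at least one [J]; one of them is
   left out of [B], which leaves room for [Q] between [B] and [J]. *)
pose B u := \sum_(l < m) A' (A l (iter (m - l.+1) J u)).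
have hB : bounded_op 0 B.
  apply: bounded_op_sum => l _.
  exact: bounded_op_comp hA' (bounded_op_comp (hA l (ltnW (ltn_ord l))) (bounded_op_iter _ hJ0)).
have [c c0 hc] := hB.2 0%N.
(* The bound [c] of [B] and the constant 3 for the derivative of [J u] give
   [norm1 (K u) <= 3 c e M], which this choice makes at most [M / 2]; [c + 1] guards against
   [c = 0]. *)
pose e : R := (6 * (c + 1))^-1.
have e0 : 0 < e by rewrite invr_gt0 mulr_gt0 // ltr_wpDl.
have [F [hF fF Fe]] := smooth_interpolation e0.
pose Q u : R -> C := u + (-1 : C) *: F u.
have hQ : bounded_op 0 Q by exact: bounded_op_add (bounded_op_id R) (bounded_op_scale _ hF).
pose K := B \o (Q \o J).
have hK : bounded_op 1 K by have := bounded_op_comp hB (bounded_op_comp hQ hJ).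
have Kc u M : V u -> (forall x, norm1 (u x) <= M) -> forall x, norm1 (K u x) <= M / 2.
  move=> Vu hu x.
  have M0 : 0 <= M by apply: le_trans (hu 0); exact: norm1_ge0.
  have VJ : V (J u) := hJ.1.1 _ Vu.
  have hQJ : bnd 0 (Q (J u)) (e * (3 * M)).
    apply: bnd0 => y; rewrite -[Q (J u) y]/(J u y + -1 * F (J u) y) mulN1r.
    exact: Fe VJ (J3 _ _ Vu hu) y.
  apply: (le_trans (bnd_val (hc _ _ (hQ.1.1 _ VJ) hQJ) x)).
  have -> : c * (e * (3 * M)) = (c / (c + 1)) * (M / 2).
    by rewrite /e; field; rewrite gt_eqF // ltr_wpDl.
  by rewrite ler_piMl ?divr_ge0 // ler_pdivrMr ?ltr_wpDl // mul1r lerDl.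
have bK := bijective_endo_id_plus hK Kc.
have lK : linear_endo V (fun u => u + K u) := linear_endo_add sV (linear_endo_id V) hK.1.
pose Em := iter m (@cderive0 R).
have lEm : linear_endo V Em := linear_endo_iter m lE.
have bEm : bijective_endo V Em := bijective_endo_iter m lE (bijective_endo_cderive0 R).
pose G := A m \o ((fun u => u + K u) \o Em).
have lG : linear_endo V G := linear_endo_comp (lA m (leqnn m)) (linear_endo_comp lK lEm).
have bG : bijective_endo V G.
  exact: bijective_endo_comp (linear_endo_comp lK lEm) bAm (bijective_endo_comp lEm bK bEm).
apply: (bijective_plus_finite_rank_index sV lG bG).
(* [D - G] is the sum of [f1], from replacing [cderive] by [cderive0], and [f2], from replacing the
   identity by [Q]. *)
have f1 : finite_rank V (fun u => \sum_(l < m.+1)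
    A l (iter l (@cderive R) u - iter l (@cderive0 R) u)).
  apply: (finite_rank_sum sV) => l _.
  exact: (finite_rank_compl sV (lA l (ltn_ord l)) (finite_rank_iter_cderive l)).
have f2 : finite_rank V ((A m \o B) \o (F \o (J \o Em))).
  apply: (finite_rank_compl sV); first exact: linear_endo_comp (lA m (leqnn m)) hB.1.
  exact: finite_rank_compr fF (linear_endo_comp hJ.1 lEm).
apply: (eq_finite_rank _ (finite_rank_add f1 f2)) => u Vu /=.
have VE l : V (iter l (@cderive0 R) u) := (linear_endo_iter l lE).1 _ Vu.
have VD l : V (iter l (@cderive R) u) := Cinf_iter_cderive l Vu.
have VJE : V (J (Em u)) := hJ.1.1 _ (VE m).
have VF : V (F (J (Em u))) := hF.1.1 _ VJE.
have iJ k l : iter k J (iter (k + l) (@cderive0 R) u) = iter l (@cderive0 R) u.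
  elim: k => // k IH; rewrite iterSr addSn iterS EJ; last exact: mem_set (VE _).
  exact: IH.
(* [A m] cancels [A'], and the [m - l] factors [J] cancel all but [l] of the factors of [Em]. *)
have AmB : A m (B (J (Em u))) = \sum_(l < m) A l (iter l (@cderive0 R) u).
  have VB (l : 'I_m) : V (A l (iter (m - l.+1) J (J (Em u)))).
    apply: (lA l (ltnW (ltn_ord l))).1; exact: (linear_endo_iter _ hJ.1).1.
  rewrite /B (linear_endo_sum sV _ (lA m (leqnn m))); last first.
    by move=> l _; apply: hA'.1.1; exact: VB.
  apply: eq_bigr => l _; rewrite AmK; last exact: VB.
  rewrite -iterSr -subSn // subSS /Em.
  by rewrite -[m in iter m (@cderive0 R) u](subnK (ltnW (ltn_ord l))) iJ.
have KE : K (Em u) = B (J (Em u)) - B (F (J (Em u))).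
  rewrite /K /= /Q (linear_endoD hB.1 VJE); last first.
    by have h := subspaceZ (-1 : R[i]) sV VF; exact: h.
  by congr (_ + _); rewrite (linear_endoZ sV (-1 : R[i]) hB.1 VF) scaleN1r.
have VBJ : V (B (J (Em u))) := hB.1.1 _ VJE.
have VBF : V (B (F (J (Em u)))) := hB.1.1 _ VF.
have GE : A m (Em u + K (Em u)) =
    \sum_(l < m.+1) A l (iter l (@cderive0 R) u) - A m (B (F (J (Em u)))).
  rewrite KE (linear_endoD (lA m (leqnn m)) (VE m)); last exact: subspaceB.
  rewrite (linear_endoB sV (lA m (leqnn m)) VBJ VBF) AmB addrA; congr (_ - _).
  by rewrite big_ord_recr addrC.
rewrite (DE _ Vu) -[G u]/(A m (Em u + K (Em u))) GE opprB addrCA [X in _ = X]addrC; congr (_ + _).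
rewrite -sumrB; apply: eq_bigr => l _.
by rewrite (linear_endoB sV (lA l (ltn_ord l)) (VD l) (VE l)).
Qed.

Section DifferentialOperator.
Variables (n : nat) (alpha : 'rV[R]_n) (m : nat).
Local Notation Zn := 'rV[int]_n.
Implicit Types b : Zn -> nat -> R -> C.

Lemma iter_Dx l u : V u -> iter l (@Dx R) u = (- 'i : C) ^+ l *: iter l (@cderive R) u.
Proof.
move=> Vu; elim: l => [|l IH]; first by rewrite scale1r.
rewrite !iterS IH; apply/funext => x; rewrite /Dx.
rewrite (cderiveZ ((- 'i : C) ^+ l) (Cinf_iter_cderive l Vu)).
rewrite -[RHS]/((- 'i : C) ^+ l.+1 * cderive (iter l (@cderive R) u) x).
by rewrite exprS -mulrA.
Qed.

(** The finite sum over orders is exchanged with the sum over the group, and [(-i)^l] passes through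
    the linear operator, which leaves operators of the crossed product. *)
Lemma diff_op_sum b u : (forall l, (l <= m)%N -> in_crossed (fun g => b g l)) -> V u ->
  diff_op alpha m b u = \sum_(l < m.+1)
    (- 'i : C) ^+ l *: crossed_op alpha (fun g => b g l) (iter l (@cderive R) u).
Proof.
move=> hb Vu; apply/funext => x; rewrite /diff_op.
have sb (l : 'I_m.+1) : smooth_family (@weight R n) (fun g => b g l).
  by apply: in_crossed_smooth; apply: hb; exact: (ltn_ord l).
have V2 (l : 'I_m.+1) : V ((- 'i : C) ^+ l *: iter l (@cderive R) u).
  exact: subspaceZ _ (Cinf_subspace R) (Cinf_iter_cderive l Vu).
pose F (l : 'I_m.+1) (g : Zn) : C := b g l (x - angle alpha g) *
  ((- 'i : C) ^+ l *: iter l (@cderive R) u) (x - angle alpha g).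
have sF l : csummable (F l).
  exact: (smooth_family_csummable (abs_summable_weight R n) x
     (smooth_family_op alpha (sb l) (V2 l))).
have -> : csum (fun g => \sum_(l < m.+1)
    Tshift alpha g (fun y => b g l y * iter l (@Dx R) u y) x) =
    csum (fun g => \sum_(l < m.+1) F l g).
  by apply: eq_csum => g; apply: eq_bigr => l _; rewrite /Tshift (iter_Dx l Vu).
have [_ ->] := csum_sum (index_enum 'I_m.+1) (fun l (_ : xpredT l) => sF l).
rewrite fct_sumE; apply: eq_bigr => l _.
rewrite -(linear_endoZ (Cinf_subspace R) ((- 'i : R[i]) ^+ l)
  (bounded_op_crossed alpha (sb l)).1 (Cinf_iter_cderive l Vu)).
by [].
Qed.

Lemma imaginary_exp_neq0 l : (- 'i : C) ^+ l != 0.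
Proof.
rewrite expf_eq0 negb_and oppr_eq0; apply/orP; right.
by rewrite eq_complex /= oner_eq0 andbF.
Qed.

(** The crossed inverse of the leading coefficient supplies [A']: its operator divided by
    [(-i)^m]. *)
Lemma diff_op_index0 b : (forall l, (l <= m)%N -> in_crossed (fun g => b g l)) ->
  crossed_invertible alpha (fun g => b g m) ->
  fredholm V (diff_op alpha m b) /\ fredholm_index V (diff_op alpha m b) = 0.
Proof.
move=> hb [b' hb']; have sV := Cinf_subspace R.
have sb l : (l <= m)%N -> smooth_family (@weight R n) (fun g => b g l).
  by move=> lm; apply: in_crossed_smooth; exact: hb.
have [/in_crossed_smooth sb' h1 h2] := hb'.
pose A l u := (- 'i : C) ^+ l *: crossed_op alpha (fun g => b g l) u.
pose A' u := ((- 'i : C) ^+ m)^-1 *: crossed_op alpha b' u.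
have cm := imaginary_exp_neq0 m.
have lb := bounded_op_crossed alpha (sb m (leqnn m)).
have lb' := bounded_op_crossed alpha sb'.
apply: (@leading_invertible_index m A A').
- by move=> l lm; apply: bounded_op_scale; apply: bounded_op_crossed; exact: sb.
- exact: bounded_op_scale lb'.
- by apply: (bijective_endo_scale cm); apply: bijective_endo_crossed_op hb'; exact: hb.
- move=> u Vu; rewrite /A /A'.
  rewrite (linear_endoZ sV (((- 'i : R[i]) ^+ m)^-1) lb.1 (lb'.1.1 _ Vu)).
  rewrite -(crossed_op_mul alpha (sb m (leqnn m)) sb' Vu) h1 crossed_op1.
  by rewrite scalerA mulfV // scale1r.
- by move=> u Vu; exact: diff_op_sum.
Qed.

End DifferentialOperator.
End Index.

Lemma circle_int0 (R : realType) : circle_int (fun=> 0 : R[i]^o) = 0 :> R[i].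
Proof.
apply: complex_ext; rewrite /= /Rintegral; under eq_integral do rewrite /=;
  by rewrite integral0.
Qed.

(** Angles are represented by reals, so a nonzero vector of the torus is one with some coordinate
    that is not a multiple of [2 * pi]. *)
Theorem mainTheorem7 (R : realType) (n : nat) (alpha : 'rV[R]_n)
    (alpha_neq0 : exists i, forall k : int, alpha 0 i <> k%:~R * (2 * pi))
    (m : nat) (b : 'rV[int]_n -> nat -> R -> R[i]^o)
    (b_decay : forall l, (l <= m)%N -> in_crossed (fun g => b g l))
    (D_elliptic : elliptic alpha m b) :
  fredholm (@Cinf_circle R) (diff_op alpha m b) /\
  (fredholm_index (@Cinf_circle R) (diff_op alpha m b))%:~R =
    - (2 * pi%:C * 'i%C)^-1 *
    circle_int (fun x => log_derive0 alpha (symbol m b 1) x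
                         - log_derive0 alpha (symbol m b (-1)) x) :> R[i].
Proof.
have [ell1 ellN1] := D_elliptic.
(* At [xi = 1] the symbol is the leading coefficient itself, whose invertibility is what
   [diff_op_index0] takes. *)
have s1E : symbol m b 1 = fun g => b g m.
  by apply/funext => g; apply/funext => x; rewrite /symbol expr1n mulr1.
have sN1E : symbol m b (-1) = fun g x => (-1) ^+ m * b g m x.
  by apply/funext => g; apply/funext => x; rewrite /symbol mulrC.
have bm := b_decay m (leqnn m).
rewrite s1E in ell1 *; rewrite sN1E in ellN1 *.
have sgn : (-1) ^+ m = 1 :> R[i]^o \/ (-1) ^+ m = -1 :> R[i]^o.
  by rewrite -signr_odd; case: (odd m); [right|left]; rewrite ?expr1 ?expr0.
have [fr ->] := diff_op_index0 b_decay ell1; split=> //.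
rewrite (log_derive0_sign sgn bm ell1 ellN1).
under [X in circle_int X]eq_fun do rewrite subrr.
by rewrite circle_int0 mulr0.
Qed.
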